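(* Let $g$ be a non-negative real-valued multiplicative function that is uniformly bounded on the primes. Assume that there is a positive constant $c$ such that for each $b$ with $0<b<1$, \[ \liminf_{x\to\infty} \big((1-b)\log x\big)^{-1} \sum_{x^b<p\le x} p^{-1} g(p)\log p \ \ge\ c, \] the sum being over primes. Then there is a positive constant $c_0$ such that for all $x\ge 2$, \[ \sum_{n\le x} g(n) \ \ge\ \frac{c_0 x}{\log x}\prod_{p\le x}\left(1+\frac{g(p)}{p}\right). \]
   Context: Multiplicative means $f(mn)=f(m)f(n)$ whenever $\gcd(m,n)=1$, with $f(1)=1$. Sums and products indexed by $p$ run over primes. *)

(* Defs.v *)
From Stdlib Require Import Reals Lra Lia List.
From mathcomp Require Import ssreflect ssrbool ssrnat div prime.
Open Scope R_scope.

Definition rsum_le (x : R) (P : nat -> bool) (f : nat -> R) : R :=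
  fold_right Rplus 0
    (map (fun n => if (P n && Rle_dec (INR n) x) then f n else 0)
         (List.seq 1 (Z.to_nat (up x)))).

Definition rprod_primes_le (x : R) (f : nat -> R) : R :=
  fold_right Rmult 1
    (map (fun n => if (prime n && Rle_dec (INR n) x) then f n else 1)
         (List.seq 1 (Z.to_nat (up x)))).

Definition multiplicative (g : nat -> R) : Prop :=
  g 1%nat = 1 /\ forall m n : nat, coprime m n -> g (m * n)%nat = g m * g n.

(* Main.v *)
Require Import Defs.
From HB Require Import structures.
From Stdlib Require Import Reals ZArith Lra Lia List Classical.
From mathcomp Require Import ssreflect ssrfun ssrbool eqtype ssrnat seq div fintype.
From mathcomp Require Import bigop prime binomial zify.
Open Scope R_scope.

(** Put [a j], the sum of [g p * ln p / p] over the primes [p] with [e^j < p <= e^(j+1)].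
    Chebyshev's bound makes [a] bounded by some [C], and the hypothesis makes its mean over
    every interval [[i, i + V)] with [V <= i <= (G - 1) V] at least [gam = c / 3] once [V] is
    large.  Such an [a] may still vanish on long intervals, so a single prime is not enough.
    Products of boundedly many primes from disjoint ranges are counted by iterated averages
    [f_(k+1) n = avg_j f_k (n - j)] with weights proportional to [a j].  The energy
    [sum_n (f_k n)^2] decreases with [k], so some step loses little of it; by the variance
    identity [f_k] is then almost invariant, in L1, under many translations.  As [f_0] is
    smooth, [f_k] is almost invariant under translation by one, and the connectedness of
    the integers propagates the invariance to all translations by at most [V].  So [f_k] is
    almost constant, and bounded below, on some interval of length [V]; one more prime
    then gives at least a constant times [y / ln x] as the sum of [g n] over [n <= y] free
    of prime factors up to [e^V], where [ln x] is of order [V].  Finally the primes up to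
    [e^V] are inserted one at a time. *)

(** * Real addition and multiplication as laws for iterated operators *)

Lemma RplusA : associative Rplus. Proof. move=> x y z; ring. Qed.
Lemma RplusC : commutative Rplus. Proof. move=> x y; ring. Qed.
Lemma Rplus0 : left_id 0 Rplus. Proof. move=> x; ring. Qed.
HB.instance Definition _ := Monoid.isComLaw.Build R 0 Rplus RplusA RplusC Rplus0.
Lemma RmultA : associative Rmult. Proof. move=> x y z; ring. Qed.
Lemma RmultC : commutative Rmult. Proof. move=> x y; ring. Qed.
Lemma Rmult1 : left_id 1 Rmult. Proof. move=> x; ring. Qed.
HB.instance Definition _ := Monoid.isComLaw.Build R 1 Rmult RmultA RmultC Rmult1.
Lemma Rmult0l : left_zero 0 Rmult. Proof. move=> x; ring. Qed.
Lemma Rmult0r : right_zero 0 Rmult. Proof. move=> x; ring. Qed.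
HB.instance Definition _ := Monoid.isMulLaw.Build R 0 Rmult Rmult0l Rmult0r.
Lemma RmultDl : left_distributive Rmult Rplus. Proof. move=> x y z; ring. Qed.
Lemma RmultDr : right_distributive Rmult Rplus. Proof. move=> x y z; ring. Qed.
HB.instance Definition _ := Monoid.isAddLaw.Build R Rmult Rplus RmultDl RmultDr.

Local Notation "\sum_ ( i < n | P ) F" :=
  (\big[Rplus/0%R]_(0%N <= i < n%N | P%B) F%R) : R_scope.
Local Notation "\sum_ ( i < n ) F" := (\big[Rplus/0%R]_(0%N <= i < n%N) F%R) : R_scope.

(** * Finite sums of reals *)

Lemma sumR_le (n : nat) (P : pred nat) (F G : nat -> R) :
  (forall i, (i < n)%N -> P i -> F i <= G i) ->
  \sum_(i < n | P i) F i <= \sum_(i < n | P i) G i.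
Proof.
move=> FG; rewrite big_nat_cond [X in _ <= X]big_nat_cond.
apply: (big_ind2 Rle) => [|x1 x2 y1 y2|i]; [lra|lra|].
by move=> /andP[/andP[_ lt_in] Pi]; apply: FG.
Qed.

Lemma sumR_eq (n : nat) (P : pred nat) (F G : nat -> R) :
  (forall i, (i < n)%N -> P i -> F i = G i) ->
  \sum_(i < n | P i) F i = \sum_(i < n | P i) G i.
Proof.
by move=> FG; apply: Rle_antisym; apply: sumR_le => i lt_in Pi;
  rewrite FG //; apply: Rle_refl.
Qed.

Lemma sumR_0 (n : nat) (P : pred nat) (F : nat -> R) :
  (forall i, (i < n)%N -> P i -> F i = 0) -> \sum_(i < n | P i) F i = 0.
Proof. by move=> F0; rewrite (sumR_eq n P F (fun=> 0)) // big1_eq. Qed.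

Lemma sumR_ge0 (n : nat) (P : pred nat) (F : nat -> R) :
  (forall i, (i < n)%N -> P i -> 0 <= F i) -> 0 <= \sum_(i < n | P i) F i.
Proof.
move=> F0; rewrite -[X in X <= _](sumR_0 n P (fun=> 0)) //.
exact: sumR_le.
Qed.

Lemma sumRMl (n : nat) (P : pred nat) (c : R) (F : nat -> R) :
  c * \sum_(i < n | P i) F i = \sum_(i < n | P i) (c * F i).
Proof. exact: big_distrr. Qed.

Lemma sumRMr (n : nat) (P : pred nat) (c : R) (F : nat -> R) :
  (\sum_(i < n | P i) F i) * c = \sum_(i < n | P i) (F i * c).
Proof. exact: big_distrl. Qed.

Lemma sumRD (n : nat) (P : pred nat) (F G : nat -> R) :
  \sum_(i < n | P i) (F i + G i) = \sum_(i < n | P i) F i + \sum_(i < n | P i) G i.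
Proof. exact: big_split. Qed.

Lemma sumRB (n : nat) (P : pred nat) (F G : nat -> R) :
  \sum_(i < n | P i) (F i - G i) = \sum_(i < n | P i) F i - \sum_(i < n | P i) G i.
Proof.
have -> : \sum_(i < n | P i) (F i - G i) = \sum_(i < n | P i) (F i + -1 * G i).
  by apply: sumR_eq => i _ _; ring.
by rewrite sumRD -sumRMl; ring.
Qed.

Lemma sumR_exchange (m n : nat) (F : nat -> nat -> R) :
  \sum_(i < m) \sum_(j < n) F i j = \sum_(j < n) \sum_(i < m) F i j.
Proof. exact: exchange_big. Qed.

Lemma sumR_const (n : nat) (c : R) : \sum_(i < n) c = INR n * c.
Proof.
elim: n => [|n IH]; first by rewrite big_nil /=; ring.
by rewrite big_nat_recr //= IH -/(INR n.+1) S_INR; ring.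
Qed.

Lemma sumR_lt_ex (n : nat) (F G : nat -> R) :
  \sum_(i < n) F i < \sum_(i < n) G i -> exists i, (i < n)%N /\ F i < G i.
Proof.
elim: n => [|n IH]; first by rewrite !big_nil; lra.
rewrite !big_nat_recr //= => H.
case: (Rlt_dec (F n) (G n)) => [?|?]; first by exists n.
case: IH => [|i [lt_in ?]]; first lra.
by exists i; split=> //; lia.
Qed.

Lemma sumR_widen (m n : nat) (F : nat -> R) :
  (m <= n)%N -> (forall i, (m <= i)%N -> F i = 0) ->
  \sum_(i < n) F i = \sum_(i < m) F i.
Proof.
move=> le_mn F0; rewrite (big_cat_nat (n := m)) //=.
rewrite [X in _ + X]big_nat_cond [X in _ + X]big1 ?Rplus_0_r //.
by move=> i /andP[/andP[le_mi _] _]; apply: F0.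
Qed.

Lemma sumR_sub_le (m n : nat) (F : nat -> R) :
  (m <= n)%N -> (forall i, 0 <= F i) -> \sum_(i < m) F i <= \sum_(i < n) F i.
Proof.
move=> le_mn F0; rewrite [X in _ <= X](big_cat_nat (n := m)) //=.
suff : 0 <= \big[Rplus/0]_(m <= i < n) F i by lra.
by apply: (big_ind (fun x => 0 <= x)) => [|x y|i _]; [lra|lra|].
Qed.

Lemma sumR_disjoint_le (n : nat) (F : nat -> R) (c : R) :
  0 <= c -> (forall i, F i <= c) ->
  (forall i j, (i < j < n)%N -> F i = 0 \/ F j = 0) ->
  \sum_(i < n) F i <= c.
Proof.
move=> c0 Fc; elim: n => [|n IH] disj; first by rewrite big_nil.
rewrite big_nat_recr //=.
case: (Req_dec (F n) 0) => [->|Fn].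
  by rewrite Rplus_0_r; apply: IH => i j ij; apply: disj; lia.
rewrite sumR_0; first by have := Fc n; lra.
by move=> i lt_in _; case: (disj i n) => //; lia.
Qed.

(** * Translates of a finitely supported sequence *)

Definition sh (j : nat) (f : nat -> R) (n : nat) : R :=
  if (j <= n)%N then f (n - j)%N else 0.

Lemma sh0 (f : nat -> R) (n : nat) : sh 0 f n = f n.
Proof. by rewrite /sh leq0n subn0. Qed.

Lemma sh_sh (i j : nat) (f : nat -> R) (n : nat) : sh i (sh j f) n = sh (j + i) f n.
Proof.
rewrite /sh; case: (leqP i n) => le_in; last by case: leqP => //; lia.
by case: (leqP j (n - i)) => le_jn; case: (leqP (j + i) n) => //; try lia;
  move=> _; congr f; lia.
Qed.

Lemma sh_supp (S j : nat) (f : nat -> R) :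
  (forall n, (S <= n)%N -> f n = 0) -> forall n, (S + j <= n)%N -> sh j f n = 0.
Proof. by move=> f0 n ?; rewrite /sh; case: leqP => // ?; apply: f0; lia. Qed.

Lemma sh_bound (C : R) (j : nat) (f : nat -> R) (n : nat) :
  (forall m, 0 <= f m <= C) -> 0 <= sh j f n <= C.
Proof. by move=> fC; rewrite /sh; case: leqP => // _; have := fC 0%N; lra. Qed.

Lemma sum_sh (M S j : nat) (f : nat -> R) :
  (forall n, (S <= n)%N -> f n = 0) -> (S + j <= M)%N ->
  \sum_(n < M) sh j f n = \sum_(n < M) f n.
Proof.
move=> f0 SjM; rewrite (big_cat_nat (n := j)) //=; last lia.
rewrite [X in X + _]big_nat_cond big1 ?Rplus_0_l; last first.
  by move=> i /andP[/andP[_ lt_ij] _]; rewrite /sh leqNgt lt_ij.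
rewrite -{1}[j]add0n big_addn.
rewrite (sumR_widen (M - j) M) ?leq_subr //; last first.
  by move=> i ?; apply: f0; lia.
by apply: sumR_eq => i _ _; rewrite /sh leq_addl addnK.
Qed.

(** L1 distance of two translates. Once [M] contains both supports, [dist_add] makes it a
    translation-invariant pseudometric on the shifts. *)
Definition dist (M : nat) (f : nat -> R) (i j : nat) : R :=
  \sum_(n < M) Rabs (sh i f n - sh j f n).

Lemma dist_ge0 M f i j : 0 <= dist M f i j.
Proof. by apply: sumR_ge0 => n _ _; apply: Rabs_pos. Qed.

Lemma dist_refl M f i : dist M f i i = 0.
Proof. by apply: sumR_0 => n _ _; rewrite Rminus_diag Rabs_R0. Qed.

Lemma dist_sym M f i j : dist M f i j = dist M f j i.
Proof. by apply: sumR_eq => n _ _; rewrite Rabs_minus_sym. Qed.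

Lemma dist_triangle M f j i k : dist M f i k <= dist M f i j + dist M f j k.
Proof.
rewrite /dist -sumRD; apply: sumR_le => n _ _.
have -> : sh i f n - sh k f n = (sh i f n - sh j f n) + (sh j f n - sh k f n) by ring.
exact: Rabs_triang.
Qed.

Lemma dist_add (M S : nat) (f : nat -> R) (i j t : nat) :
  (forall n, (S <= n)%N -> f n = 0) -> (S + maxn i j + t <= M)%N ->
  dist M f (i + t) (j + t) = dist M f i j.
Proof.
move=> f0 SM; rewrite /dist.
rewrite -[RHS](sum_sh M (S + maxn i j) t) //; last first.
  by move=> n ?; rewrite !(sh_supp S) ?Rminus_diag ?Rabs_R0 //; lia.
apply: sumR_eq => n _ _; rewrite -!sh_sh /sh.
by case: leqP => // _; rewrite Rminus_diag Rabs_R0.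
Qed.

(** Both sides are twice the variance of [u] under the weights [m]; the left one is the mean square
    difference of two independent samples. *)
Lemma sumR_variance (n : nat) (m u : nat -> R) :
  \sum_(j < n) m j = 1 ->
  \sum_(j < n) \sum_(i < n) m j * m i * (u j - u i) ^ 2 =
  2 * (\sum_(j < n) m j * u j ^ 2) - 2 * (\sum_(j < n) m j * u j) ^ 2.
Proof.
move=> m1; set B := \sum_(j < n) m j * u j; set D := \sum_(j < n) m j * u j ^ 2.
have H j : \sum_(i < n) m j * m i * (u j - u i) ^ 2 =
    m j * u j ^ 2 + (-2 * B) * (m j * u j) + D * m j.
  have -> : \sum_(i < n) m j * m i * (u j - u i) ^ 2 =
     \sum_(i < n) (m j * u j ^ 2 * m i + (-2 * m j * u j) * (m i * u i)
                     + m j * (m i * u i ^ 2)).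
    by apply: sumR_eq => i _ _; ring.
  by rewrite !sumRD -!sumRMl m1 -/B -/D; ring.
rewrite (eq_bigr _ (fun j _ => H j)) !sumRD -!sumRMl m1 -/B -/D; ring.
Qed.

(** The variance identity is applied at each [n] and summed. The window [M] contains every translate
    by less than [V], so all these translates of [f] have the same energy. *)
Lemma energy_drop (M S V : nat) (m f : nat -> R) :
  \sum_(j < V) m j = 1 -> (forall n, (S <= n)%N -> f n = 0) -> (S + V <= M)%N ->
  \sum_(j < V) \sum_(i < V) (m j * m i * \sum_(n < M) (sh j f n - sh i f n) ^ 2) =
  2 * (\sum_(n < M) f n ^ 2 - \sum_(n < M) (\sum_(j < V) m j * sh j f n) ^ 2).
Proof.
move=> m1 f0 SVM.
transitivity (\sum_(n < M) \sum_(j < V) \sum_(i < V)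
    m j * m i * (sh j f n - sh i f n) ^ 2).
  rewrite [RHS]sumR_exchange; apply: sumR_eq => j _ _.
  by rewrite [RHS]sumR_exchange; apply: sumR_eq => i _ _; rewrite sumRMl.
rewrite (eq_bigr _ (fun n _ => sumR_variance V m (fun j => sh j f n) m1)).
rewrite sumRB -!sumRMl sumR_exchange.
suff -> : \sum_(j < V) \sum_(n < M) m j * sh j f n ^ 2 = \sum_(n < M) f n ^ 2 by ring.
transitivity (\sum_(j < V) m j * \sum_(n < M) f n ^ 2); last by rewrite -sumRMr m1; ring.
apply: sumR_eq => j lt_jV _; rewrite -sumRMl; congr (_ * _).
rewrite -(sum_sh M S j (fun n => f n ^ 2)); first last.
- lia.
- by move=> n ?; rewrite f0 //; ring.
by apply: sumR_eq => n _ _; rewrite /sh; case: leqP => // _; ring.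
Qed.

(** * Almost invariance under translations *)

(** An informative [sig] rather than [exists], since [dist_levels] needs one point per level as a
    function of the level. *)
Lemma discrete_ivt (d : nat -> R) (th t : R) (r : nat) :
  d 0%N = 0 -> (forall n, (n < r)%N -> d n.+1 <= d n + th) -> 0 <= th ->
  0 <= t -> t <= d r -> {n : nat | (n <= r)%N /\ t <= d n <= t + th}.
Proof.
move=> d0 dS th0 t0; elim: r dS => [|r IH] dS tr; first by exists 0%N; split=> //; lra.
case: (Rle_dec t (d r)) => [tdr|tdr].
  case: IH => // [n ?|n [? ?]]; first by apply: dS; lia.
  by exists n; split=> //; lia.
by exists r.+1; split=> //; have := dS r (ltnSn r); lra.
Qed.

Lemma pos_INR_lt (n : nat) : (0 < n)%N -> 0 < INR n.
Proof. by move=> ?; apply: lt_0_INR; lia. Qed.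

Lemma leq_INR (m n : nat) : (m <= n)%N -> INR m <= INR n.
Proof. by move=> ?; apply: le_INR; lia. Qed.

(* Level points of [dist M f 0] are far apart, so translating the heavy set
   [dist M f j i0 <= th] by them gives disjoint sets: there are few levels. *)
Lemma dist_levels (M S V Q : nat) (f m : nat -> R) (th c : R) (i0 r : nat) :
  (forall n, (S <= n)%N -> f n = 0) -> (S + V + V + 1 <= M)%N ->
  0 < th -> dist M f 0 1 <= th -> (i0 < V)%N ->
  (forall j, 0 <= m j <= c) ->
  1 / 2 <= \sum_(j < V) (if Rle_dec (dist M f j i0) th then m j else 0) ->
  (r <= V)%N -> 4 * INR Q * th < dist M f 0 r -> INR Q / 2 <= c * (2 * INR V).
Proof.
move=> f0 SVM th0 d01 i0V mc mD rV big.
have dS n : (n < r)%N -> dist M f 0 n.+1 <= dist M f 0 n + th.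
  move=> ?; apply: Rle_trans (dist_triangle M f n _ _) _.
  have := dist_add M S f 0 1 n f0; rewrite add0n add1n => -> //; first lra.
  by rewrite /maxn /=; lia.
have lev (l : nat) : {n : nat | (l < Q)%N ->
    (n <= r)%N /\ 4 * INR l * th <= dist M f 0 n <= 4 * INR l * th + th}.
  case: (ltnP l Q) => lQ; last by exists 0%N.
  have [|||n Hn] := discrete_ivt _ _ (4 * INR l * th) r (dist_refl M f 0) dS; [lra| | |].
  - by have := pos_INR l; nra.
  - have : INR l <= INR Q by apply: leq_INR; lia.
    by nra.
  by exists n.
pose nl l := sval (lev l).
have nlP l : (l < Q)%N ->
    (nl l <= r)%N /\ 4 * INR l * th <= dist M f 0 (nl l) <= 4 * INR l * th + th.
  exact: svalP (lev l).
pose nu j := if (j < V)%N then (if Rle_dec (dist M f j i0) th then m j else 0) else 0.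
have nuV n : (V <= n)%N -> nu n = 0 by rewrite /nu ltnNge => ->.
have nuc j : 0 <= nu j <= c.
  have [? ?] := mc j.
  by rewrite /nu; case: ltnP => _; [case: Rle_dec => ? /=|]; lra.
(* Double counting: each of the [Q] translates of [nu] has mass at least one half, while
   disjointness bounds the total mass by [c] times the length [2 V]. *)
have lo : INR Q / 2 <= \sum_(l < Q) \sum_(n < V + V) sh (nl l) nu n.
  have -> : INR Q / 2 = \sum_(l < Q) (1 / 2) by rewrite sumR_const; lra.
  apply: sumR_le => l lQ _; have [nlr _] := nlP l lQ.
  rewrite (sum_sh _ V) //; last lia.
  rewrite (sumR_widen V (V + V)) ?leq_addr //.
  apply: Rle_trans mD _; apply: sumR_le => j jV _; rewrite /nu jV; lra.
apply: Rle_trans lo _; rewrite sumR_exchange.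
have -> : c * (2 * INR V) = \sum_(n < V + V) c by rewrite sumR_const plus_INR; lra.
apply: sumR_le => n _ _; apply: sumR_disjoint_le.
- by have := mc 0%N; lra.
- by move=> l; have := sh_bound c (nl l) nu n nuc; lra.
move=> l l' /andP[ll' l'Q].
have lQ : (l < Q)%N by lia.
have [nr [nlo nhi]] := nlP l lQ; have [nr' [nlo' nhi']] := nlP l' l'Q.
rewrite /sh; case: (leqP (nl l) n) => h1; last by left.
case: (leqP (nl l') n) => h2; last by right.
rewrite /nu; case: (ltnP (n - nl l)) => h3; last by left.
case: (ltnP (n - nl l')) => h4; last by right.
case: Rle_dec => D1; last by left.
case: Rle_dec => D2; last by right.
(* If both translates contain [n], then [nl l] and [nl l'] are within [2 * th] of each other,
   although their levels differ by at least [3 * th]. *)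
exfalso.
have E1 : dist M f (n - nl l + nl l) (i0 + nl l) <= th.
  by rewrite (dist_add M S) //; lia.
have E2 : dist M f (n - nl l' + nl l') (i0 + nl l') <= th.
  by rewrite (dist_add M S) //; lia.
rewrite !subnK // in E1 E2.
have E3 : dist M f (nl l) (nl l') <= th + th.
  rewrite -(dist_add M S f _ _ i0) //; last by lia.
  apply: Rle_trans (dist_triangle M f n _ _) _.
  by rewrite ![(_ + i0)%N]addnC dist_sym; lra.
have E4 := dist_triangle M f (nl l) 0 (nl l').
have : INR l + 1 <= INR l' by rewrite -S_INR; apply: leq_INR.
nra.
Qed.

(** Expand [(Rabs u - k) ^ 2 >= 0]. This passes from L2 to L1 bounds without a square root. *)
Lemma Rabs_amgm (u k : R) : 0 < k -> Rabs u <= k / 2 + u ^ 2 / (2 * k).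
Proof.
move=> k0; have -> : u ^ 2 = Rabs u ^ 2 by rewrite pow2_abs.
have -> : k / 2 + Rabs u ^ 2 / (2 * k) = Rabs u + (Rabs u - k) ^ 2 / (2 * k) by field; lra.
have : 0 <= (Rabs u - k) ^ 2 / (2 * k).
  by apply: Rle_mult_inv_pos; [apply: pow2_ge_0|lra].
lra.
Qed.

(** By [energy_drop] the weighted mean of [dist M f j i] is at most [e = 4 C W / K]. Hence some [i0]
    has at least half of the weight within distance [4 e]. By [dist_levels] with [th = 4 e], a
    distance above [16 Q e] would give [Q / 2 <= 2 C / gam], against the size of [Q]. *)
Lemma dist_le_of_energy (C gam : R) (Q K V W S : nat) (a f : nat -> R) :
  0 < gam -> 0 < C -> (0 < V <= W)%N -> (2 < W)%N -> (0 < K)%N -> 4 * C / gam < INR Q ->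
  (S <= 2 * W)%N -> (S + 2 * V < 4 * W)%N -> (forall n, (S <= n)%N -> f n = 0) ->
  (forall j, 0 <= a j <= C) -> gam * INR V <= \sum_(j < V) a j ->
  (forall n, Rabs (f n - sh 1 f n) <= C / INR K) ->
  \sum_(n < 4 * W) f n ^ 2 -
    \sum_(n < 4 * W) (\sum_(j < V) (a j / \sum_(i < V) a i) * sh j f n) ^ 2
    <= 2 * C ^ 2 * INR W / INR K ^ 2 ->
  forall r, (r <= V)%N -> dist (4 * W) f 0 r <= 64 * INR Q * C * INR W / INR K.
Proof.
move=> g0 C0 /andP[V0 VW] W2 K0 Qbig SW SVW fS aC Alo smooth drop r rV.
set M := (4 * W)%N in SVW drop *.
set A := \sum_(i < V) a i in Alo drop.
have rV0 := pos_INR_lt V V0; have rK0 := pos_INR_lt K K0.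
have rW0 : 0 < INR W by apply: pos_INR_lt; lia.
have A0 : 0 < A by nra.
pose m j := a j / A.
have m1 : \sum_(j < V) m j = 1.
  by rewrite /m /Rdiv -sumRMr -/A; field; lra.
have mc j : 0 <= m j <= C / (gam * INR V).
  have [? ?] := aC j; split; first by apply: Rle_mult_inv_pos.
  have gV0 : 0 < gam * INR V by apply: Rmult_lt_0_compat.
  apply: Rmult_le_compat => //; first by apply: Rlt_le; apply: Rinv_0_lt_compat.
  exact: Rinv_le_contravar.
have E := energy_drop M S V m f m1 fS.
have {E drop} E : \sum_(j < V) \sum_(i < V) (m j * m i * \sum_(n < M) (sh j f n - sh i f n) ^ 2)
     <= 4 * C ^ 2 * INR W / INR K ^ 2.
  rewrite E; last lia.
  have -> : 4 * C ^ 2 * INR W / INR K ^ 2 = 2 * (2 * C ^ 2 * INR W / INR K ^ 2).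
    by field; lra.
  by apply: Rmult_le_compat_l; [lra|exact: drop].
have rM : INR M = 4 * INR W by rewrite /M mult_INR /=; ring.
pose e := 4 * C * INR W / INR K.
have e0 : 0 < e by apply: Rmult_lt_0_compat; [nra|apply: Rinv_0_lt_compat].
have L1 : \sum_(i < V) m i * (\sum_(j < V) m j * dist M f j i) <= e.
  (* The parameter [C / K] balances the two terms of [Rabs_amgm]: each contributes [2 C W / K] in
     total. *)
  have k0 : 0 < C / INR K by apply: Rmult_lt_0_compat => //; apply: Rinv_0_lt_compat.
  have step i j : dist M f j i <= 2 * INR W * (C / INR K) +
       / (2 * (C / INR K)) * \sum_(n < M) (sh j f n - sh i f n) ^ 2.
    have -> : 2 * INR W * (C / INR K) = \sum_(n < M) (C / INR K) / 2.
      by rewrite sumR_const rM; field; lra.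
    rewrite sumRMl -sumRD; apply: sumR_le => n _ _.
    have := Rabs_amgm (sh j f n - sh i f n) _ k0.
    by rewrite /Rdiv [_ * / (2 * (C * / INR K))]Rmult_comm.
  apply: (Rle_trans _ (\sum_(i < V) \sum_(j < V) (m i * m j * (2 * INR W * (C / INR K)) +
       / (2 * (C / INR K)) * (m j * m i * \sum_(n < M) (sh j f n - sh i f n) ^ 2)))).
    apply: sumR_le => i _ _; rewrite sumRMl; apply: sumR_le => j _ _.
    have [? _] := mc i; have [? _] := mc j; have := step i j => ?.
    apply: (Rle_trans _ (m i * m j * (2 * INR W * (C / INR K) +
       / (2 * (C / INR K)) * \sum_(n < M) (sh j f n - sh i f n) ^ 2))).
      by rewrite -Rmult_assoc; apply: Rmult_le_compat_l => //; nra.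
    by apply: Req_le; ring.
  have -> : \sum_(i < V) \sum_(j < V) (m i * m j * (2 * INR W * (C / INR K)) +
       / (2 * (C / INR K)) * (m j * m i * \sum_(n < M) (sh j f n - sh i f n) ^ 2)) =
     2 * INR W * (C / INR K) + / (2 * (C / INR K)) *
       \sum_(j < V) \sum_(i < V) (m j * m i * \sum_(n < M) (sh j f n - sh i f n) ^ 2).
    rewrite [in RHS]sumR_exchange.
    transitivity (\sum_(i < V) (m i * (2 * INR W * (C / INR K)) + / (2 * (C / INR K)) *
        \sum_(j < V) (m j * m i * \sum_(n < M) (sh j f n - sh i f n) ^ 2))).
      apply: sumR_eq => i _ _; rewrite sumRD sumRMl; congr (_ + _).
      by rewrite -sumRMr -sumRMl m1; ring.
    by rewrite sumRD -sumRMr m1 -sumRMl Rmult_1_l.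
  apply: (Rle_trans _ (2 * INR W * (C / INR K) +
     / (2 * (C / INR K)) * (4 * C ^ 2 * INR W / INR K ^ 2))).
    apply: Rplus_le_compat_l; apply: Rmult_le_compat_l => //.
    by apply: Rlt_le; apply: Rinv_0_lt_compat; lra.
  by rewrite /e; apply: Req_le; field; lra.
have [i0 [i0V Hi0]] : exists i, (i < V)%N /\
    m i * (\sum_(j < V) m j * dist M f j i) < m i * (2 * e).
  apply: sumR_lt_ex; rewrite -sumRMr m1; lra.
have {}Hi0 : \sum_(j < V) m j * dist M f j i0 < 2 * e.
  by have := mc i0; nra.
apply: Rnot_lt_le => far.
have far' : 4 * INR Q * (4 * e) < dist M f 0 r.
  have -> : 4 * INR Q * (4 * e) = 64 * INR Q * C * INR W / INR K by rewrite /e; field; lra.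
  exact: far.
have d01 : dist M f 0 1 <= 4 * e.
  apply: (Rle_trans _ (\sum_(n < M) (C / INR K))).
    by apply: sumR_le => n _ _; rewrite sh0.
  rewrite sumR_const rM.
  suff -> : 4 * INR W * (C / INR K) = e by lra.
  by rewrite /e; field; lra.
(* Markov's inequality: the mean distance to [i0] is below [2 e], so the indices beyond [4 e] carry
   less than half of the weight. *)
have mD : 1 / 2 <= \sum_(j < V) (if Rle_dec (dist M f j i0) (4 * e) then m j else 0).
  have -> : \sum_(j < V) (if Rle_dec (dist M f j i0) (4 * e) then m j else 0) =
     1 - \sum_(j < V) (if Rle_dec (dist M f j i0) (4 * e) then 0 else m j).
    rewrite -m1 -sumRB; apply: sumR_eq => j _ _; case: Rle_dec => ? /=; ring.
  suff : 4 * e * \sum_(j < V) (if Rle_dec (dist M f j i0) (4 * e) then 0 else m j) < 2 * e.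
    by nra.
  apply: Rle_lt_trans Hi0; rewrite sumRMl; apply: sumR_le => j _ _.
  have [? _] := mc j; have := dist_ge0 M f j i0; case: Rle_dec => ? /= ?; nra.
have : INR Q / 2 <= C / (gam * INR V) * (2 * INR V).
  apply: (dist_levels M S V Q f m (4 * e) _ i0 r) => //; [lia|lra].
have -> : C / (gam * INR V) * (2 * INR V) = 4 * C / gam / 2 by field; lra.
lra.
Qed.

Fixpoint smoothed (V : nat) (a : nat -> nat -> R) (f0 : nat -> R) (k : nat) : nat -> R :=
  if k is k'.+1 then
    fun n => \sum_(j < V) (a k' j / \sum_(i < V) a k' i) * sh j (smoothed V a f0 k') n
  else f0.

Lemma sumR_shift_le (n r M : nat) (F : nat -> R) :
  (n + r <= M)%N -> (forall i, 0 <= F i) -> \sum_(i < n) F (i + r)%N <= \sum_(i < M) F i.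
Proof.
move=> nrM F0; apply: Rle_trans (sumR_sub_le _ _ F nrM F0).
rewrite [X in _ <= X](big_cat_nat (n := r)) ?leq_addl //=.
rewrite -{3}[r]add0n big_addn addnK.
have := sumR_ge0 r xpredT F (fun i _ _ => F0 i); lra.
Qed.

Lemma average_bounds (V : nat) (m u : nat -> R) (lo hi : R) :
  (forall j, (j < V)%N -> 0 <= m j) -> \sum_(j < V) m j = 1 ->
  (forall j, lo <= u j <= hi) -> lo <= \sum_(j < V) m j * u j <= hi.
Proof.
move=> m0 m1 ub; split.
  have {1}-> : lo = \sum_(j < V) m j * lo by rewrite -sumRMr m1; ring.
  apply: sumR_le => j jV _; have := m0 j jV; have := ub j; nra.
have -> : hi = \sum_(j < V) m j * hi by rewrite -sumRMr m1; ring.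
apply: sumR_le => j jV _; have := m0 j jV; have := ub j; nra.
Qed.

Lemma normalize_sum (V : nat) (a : nat -> R) :
  0 < \sum_(i < V) a i -> \sum_(j < V) (a j / \sum_(i < V) a i) = 1.
Proof. by move=> A0; rewrite /Rdiv -sumRMr; field; lra. Qed.

Lemma Rabs_le_bounds (u e : R) : Rabs u <= e -> - e <= u <= e.
Proof. by have := Rle_abs u; have := Rle_abs (- u); rewrite Rabs_Ropp; lra. Qed.

(** Each step averages translates by less than [V] with total weight 1: bounds, increments and mass
    persist, and the support grows by at most [V]. *)
Lemma smoothed_props (V M S : nat) (C e : R) (a : nat -> nat -> R) (f0 : nat -> R) (k : nat) :
  (forall i j, 0 <= a i j) -> (forall i, (i < k)%N -> 0 < \sum_(j < V) a i j) ->
  (forall n, 0 <= f0 n <= C) -> (forall n, (S <= n)%N -> f0 n = 0) ->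
  (forall n, Rabs (f0 n - sh 1 f0 n) <= e) -> (S + k * V <= M)%N ->
  let f := smoothed V a f0 k in
  [/\ forall n, 0 <= f n <= C, forall n, (S + k * V <= n)%N -> f n = 0,
      forall n, Rabs (f n - sh 1 f n) <= e
    & \sum_(n < M) f n = \sum_(n < M) f0 n].
Proof.
move=> a0 A0 f0C f0S f0e; elim: k A0 => [|k IH] A0 SM f.
  by split=> // n; rewrite mul0n addn0; apply: f0S.
case: IH => [i ik||]; [apply: A0; lia|lia|].
set h := smoothed V a f0 k => hC hS he hM.
have m1 := normalize_sum V (a k) (A0 k (ltnSn k)).
set m := fun j => a k j / \sum_(i < V) a k i in m1.
have fE n : f n = \sum_(j < V) m j * sh j h n by [].
have m0 j : (j < V)%N -> 0 <= m j by move=> _; apply: Rle_mult_inv_pos => //; apply: A0.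
split=> [n|n nS|n|].
- by rewrite fE; apply: average_bounds => // j; apply: sh_bound.
- rewrite fE; apply: sumR_0 => j jV _.
  by rewrite (sh_supp (S + k * V)) ?Rmult_0_r //; lia.
- have -> : f n - sh 1 f n = \sum_(j < V) m j * (sh j h n - sh 1 (sh j h) n).
    rewrite fE /sh; case: (leqP 1 n) => n1.
      by rewrite fE -sumRB; apply: sumR_eq => j _ _; rewrite /sh; ring.
    by rewrite Rminus_0_r; apply: sumR_eq => j _ _; ring.
  apply: Rabs_le; apply: average_bounds => // j.
  apply: Rabs_le_bounds; rewrite !sh_sh.
  have -> : sh j h n - sh (j + 1) h n = sh j (fun n => h n - sh 1 h n) n.
    by rewrite addnC -sh_sh /sh; case: (leqP j n) => // _; ring.
  rewrite {1}/sh; case: (leqP j n) => // _.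
  by rewrite Rabs_R0; apply: Rle_trans (Rabs_pos _) (he 0%N).
- transitivity (\sum_(j < V) m j * \sum_(n < M) h n); last by rewrite -sumRMr m1 hM; ring.
  transitivity (\sum_(n < M) \sum_(j < V) m j * sh j h n) => //.
  rewrite sumR_exchange; apply: sumR_eq => j jV _.
  by rewrite -sumRMl (sum_sh M (S + k * V)) //; lia.
Qed.

(** The drops telescope, and their sum cannot exceed [E 0]. *)
Lemma pigeonhole_drop (E : nat -> R) (n : nat) (d : R) :
  (forall k, 0 <= E k) -> E 0%N <= INR n * d -> (0 < n)%N ->
  exists k, (k < n)%N /\ E k - E k.+1 <= d.
Proof.
case: n => // n E0 En _.
have tele m : \sum_(k < m) (E k - E k.+1) = E 0%N - E m.
  by elim: m => [|m IH]; rewrite ?big_nil ?big_nat_recr //= ?IH; ring.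
case: (Rle_dec (E n - E n.+1) d) => [?|big]; first by exists n.
have [|k [kn ?]] := sumR_lt_ex n (fun k => E k - E k.+1) (fun=> d).
  rewrite tele sumR_const; have := E0 n.+1; rewrite S_INR in En; lra.
by exists k; split; [lia|lra].
Qed.

(** The initial energy is at most [2 W C^2], so one of the [K^2] steps loses at most
    [2 C^2 W / K^2], and [dist_le_of_energy] applies to it. Averaging over [n < 2 W], where [f] has
    mass at least [gam W], then yields one good point. *)
Lemma smoothed_flat (C gam : R) (Q K V W S : nat) (a : nat -> nat -> R) (f0 : nat -> R) :
  0 < gam -> 0 < C -> (0 < V < W)%N -> (2 < W)%N ->
  4 * C / gam < INR Q -> 256 * INR Q * C ^ 2 / gam ^ 2 < INR K ->
  (S + K ^ 2 * V <= 2 * W)%N ->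
  (forall n, 0 <= f0 n <= C) -> (forall n, (S <= n)%N -> f0 n = 0) ->
  (forall n, Rabs (f0 n - sh 1 f0 n) <= C / INR K) ->
  gam * INR W <= \sum_(n < 4 * W) f0 n ->
  (forall i j, 0 <= a i j <= C) ->
  (forall i, (i < K ^ 2)%N -> gam * INR V <= \sum_(j < V) a i j) ->
  exists k n0, let f := smoothed V a f0 k in [/\ (k < K ^ 2)%N, gam / 4 <= f n0 &
    \sum_(r < V) Rabs (f (n0 + r)%N - f n0) <= gam / (2 * C) * INR V * f n0].
Proof.
move=> g0 C0 /andP[V0 VW] W2 Qbig Kbig SKW f0C f0S smooth mass aC Alo.
have rV0 := pos_INR_lt V V0.
have rW0 : 0 < INR W by apply: pos_INR_lt; lia.
have rQ0 : 0 < INR Q.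
  by apply: Rle_lt_trans Qbig; apply: Rle_mult_inv_pos => //; lra.
have rK0 : 0 < INR K.
  by apply: Rle_lt_trans Kbig; apply: Rle_mult_inv_pos; nra.
have K0 : (0 < K)%N by case: (K) rK0 => //=; lra.
have A0 i : (i < K ^ 2)%N -> 0 < \sum_(j < V) a i j by move=> /Alo; nra.
have P k : (k <= K ^ 2)%N -> _ := fun kK => smoothed_props V (4 * W) S C (C / INR K) a f0 k
  (fun i j => proj1 (aC i j)) (fun i ik => A0 i (leq_trans ik kK)) f0C f0S smooth.
pose E k := \sum_(n < 4 * W) smoothed V a f0 k n ^ 2.
have rK2 : INR (K ^ 2) = INR K ^ 2 by rewrite -mulnn mult_INR /=; ring.
have [k [kK drop]] : exists k, (k < K ^ 2)%N /\ E k - E k.+1 <= 2 * C ^ 2 * INR W / INR K ^ 2.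
  apply: pigeonhole_drop; last by rewrite expn_gt0 K0.
    by move=> k; apply: sumR_ge0 => n _ _; apply: pow2_ge_0.
  rewrite rK2.
  have -> : INR K ^ 2 * (2 * C ^ 2 * INR W / INR K ^ 2) = 2 * INR W * C ^ 2 by field; lra.
  rewrite /E (sumR_widen (2 * W) (4 * W)) /=; first last.
  - by move=> n ?; rewrite f0S; [ring|lia].
  - lia.
  have -> : 2 * INR W * (C * (C * 1)) = \sum_(n < 2 * W) C ^ 2.
    by rewrite sumR_const mult_INR /=; ring.
  by apply: sumR_le => n _ _; have := f0C n; nra.
have kV : (k * V <= K ^ 2 * V)%N by rewrite leq_mul2r (ltnW kK) orbT.
have [||fC fS fe fM] := P k; [exact: ltnW|lia|].
set f := smoothed V a f0 k in fC fS fe fM.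
have dle : forall r, (r <= V)%N -> dist (4 * W) f 0 r <= 64 * INR Q * C * INR W / INR K.
  apply: (dist_le_of_energy C gam Q K V W (S + k * V) (a k) f) => //; try lia.
  exact: Alo.
(* Comparing with [f n - gam / 4] instead of [f n] gives both conclusions at the same point, as the
   left side is nonnegative. The subtraction costs at most half of the mass. *)
have [n [nW Hn]] : exists n, (n < 2 * W)%N /\
    \sum_(r < V) Rabs (f (n + r)%N - f n) < gam / (2 * C) * INR V * (f n - gam / 4).
  apply: sumR_lt_ex; rewrite sumR_exchange -sumRMl sumRB sumR_const.
  have -> : \sum_(n < 2 * W) f n = \sum_(n < 4 * W) f0 n.
    by rewrite -fM (sumR_widen (2 * W) (4 * W)) //; [lia|move=> n ?; apply: fS; lia].
  apply: (Rle_lt_trans _ (\sum_(r < V) (64 * INR Q * C * INR W / INR K))).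
    apply: sumR_le => r rV _; apply: Rle_trans (dle r (ltnW rV)).
    apply: Rle_trans (sumR_shift_le (2 * W) r (4 * W)
      (fun n => Rabs (sh 0 f n - sh r f n)) _ (fun n => Rabs_pos _)); last lia.
    by apply: sumR_le => n _ _; rewrite sh0 /sh leq_addl addnK; apply: Rle_refl.
  rewrite sumR_const mult_INR.
  apply: (Rlt_le_trans _ (gam / (2 * C) * INR V * (gam * INR W - INR 2 * INR W * (gam / 4)))).
    have -> : gam / (2 * C) * INR V * (gam * INR W - INR 2 * INR W * (gam / 4)) =
       INR V * (gam ^ 2 / (4 * C) * INR W) by rewrite /=; field; lra.
    apply: Rmult_lt_compat_l => //.
    (* The comparison reduces to [256 Q C^2 / gam^2 < K]. *)
    have -> : 64 * INR Q * C * INR W / INR K =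
       (256 * INR Q * C ^ 2 / gam ^ 2) * (gam ^ 2 / (4 * C) * INR W / INR K) by field; lra.
    have {2}-> : gam ^ 2 / (4 * C) * INR W = INR K * (gam ^ 2 / (4 * C) * INR W / INR K).
      by field; lra.
    apply: Rmult_lt_compat_r => //.
    by repeat (apply: Rmult_lt_0_compat || apply: Rinv_0_lt_compat); lra.
  apply: Rmult_le_compat_l; last lra.
  by apply: Rlt_le; repeat (apply: Rmult_lt_0_compat || apply: Rinv_0_lt_compat); lra.
exists k, n; rewrite -/f; split=> //.
- have : 0 <= \sum_(r < V) Rabs (f (n + r)%N - f n).
    by apply: sumR_ge0 => r _ _; apply: Rabs_pos.
  move=> ge0; have {ge0 Hn} : 0 < gam / (2 * C) * INR V * (f n - gam / 4) by lra.
  have : 0 < gam / (2 * C) * INR V.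
    by repeat (apply: Rmult_lt_0_compat || apply: Rinv_0_lt_compat); lra.
  nra.
- apply: Rlt_le; apply: Rlt_le_trans Hn _; apply: Rmult_le_compat_l; last lra.
  by apply: Rlt_le; repeat (apply: Rmult_lt_0_compat || apply: Rinv_0_lt_compat); lra.
Qed.

(** * Chebyshev's upper bound *)

Lemma prime_ndvd_fact (p m : nat) : prime p -> (m < p)%N -> ~~ (p %| m`!)%N.
Proof.
move=> pp; elim: m => [|m IH] mp; first by rewrite fact0 Euclid_dvd1.
rewrite factS Euclid_dvdM // negb_or IH ?andbT; last exact: ltnW.
by rewrite gtnNdvd.
Qed.

(** The primes in [(m, 2 m]] divide the product [C(2m, m) m!] of all integers there and are coprime
    to [m!]. So their product divides the binomial coefficient, which is a term of the expansion of
    [(1 + 1)^(2 m)]. *)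
Lemma prod_primes_middle_le (m : nat) :
  (\prod_(m.+1 <= p < (m + m).+1 | prime p) p <= 4 ^ m)%N.
Proof.
set P := (\prod_(_ <= p < _ | prime p) p)%N.
have split : ('C(m + m, m) * m`! = \prod_(m.+1 <= i < (m + m).+1) i)%N.
  apply/eqP; rewrite -(eqn_pmul2r (fact_gt0 m)) -mulnA; apply/eqP.
  have := bin_fact (leq_addr m m); rewrite addnK => ->.
  by rewrite fact_prod (big_cat_nat (n := m.+1)) //= ?ltnS ?leq_addr // -fact_prod mulnC.
have dvdP : (P %| 'C(m + m, m) * m`!)%N.
  by rewrite split (bigID prime) /= dvdn_mulr.
have copP : coprime P m`!.
  rewrite /P big_nat_cond; apply: (big_ind (fun x => coprime x m`!)).
  - exact: coprime1n.
  - by move=> x y; rewrite coprimeMl => -> ->.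
  - by move=> p /andP[/andP[mp _] pp]; rewrite prime_coprime // prime_ndvd_fact.
rewrite Gauss_dvdl // in dvdP.
apply: leq_trans (dvdn_leq _ dvdP) _; first by rewrite bin_gt0 leq_addr.
have -> : (4 ^ m = (1 + 1) ^ (m + m))%N by rewrite expnD -expnMn.
rewrite expnDn (bigD1 (inord m)) //= inordK ?ltnS ?leq_addr //.
by rewrite !exp1n !muln1 leq_addr.
Qed.

Definition primorial (n : nat) : nat := (\prod_(0 <= p < n.+1 | prime p) p)%N.

Lemma primorial_gt0 (n : nat) : (0 < primorial n)%N.
Proof. by rewrite prodn_cond_gt0 // => p /prime_gt0. Qed.

Lemma primorial_mono (m n : nat) : (m <= n)%N -> (primorial m <= primorial n)%N.
Proof.
move=> mn; rewrite [X in (_ <= X)%N]/primorial (big_cat_nat (n := m.+1)) //=.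
by rewrite leq_pmulr // prodn_cond_gt0 // => p /prime_gt0.
Qed.

(** Strong induction from [n] to its upper half [m]. The base 16 absorbs the rounding: the bound
    [16^m 4^m] has exponent [6 m <= 3 n + 3 <= 4 n] in base 2 once [n >= 3]. *)
Lemma primorial_le (n : nat) : (primorial n <= 16 ^ n)%N.
Proof.
elim/ltn_ind: n => n IH.
case: (ltnP n 3) => n3.
  by case: n n3 {IH} => [|[|[|]]] // _; rewrite /primorial /index_iota /= unlock.
have [m mn nm] : exists2 m, (m < n)%N & (n <= m + m <= n.+1)%N.
  by exists (uphalf n); lia.
apply: (leq_trans (primorial_mono n (m + m) _)); first lia.
rewrite /primorial (big_cat_nat (n := m.+1)) //= ?ltnS ?leq_addr //.
apply: (leq_trans (leq_mul (IH m mn) (prod_primes_middle_le m))).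
by rewrite (_ : 16 = 2 ^ 4)%N // (_ : 4 = 2 ^ 2)%N // -!expnM -expnD leq_exp2l //; lia.
Qed.

Lemma sum_ln_primes_le (n : nat) :
  \sum_(p < n.+1 | prime p) ln (INR p) <= INR n * ln 16.
Proof.
have -> : \sum_(p < n.+1 | prime p) ln (INR p) = ln (INR (primorial n)).
  apply: esym; rewrite /primorial.
  have : (0 < \prod_(0 <= p < n.+1 | prime p) p)%N /\
     ln (INR (\prod_(0 <= p < n.+1 | prime p) p)) = \sum_(p < n.+1 | prime p) ln (INR p).
    apply: (big_ind2 (fun x y => (0 < x)%N /\ ln (INR x) = y)).
    - by split=> //=; rewrite ln_1.
    - move=> x1 x2 y1 y2 [x1p <-] [y1p <-]; split; first by rewrite muln_gt0 x1p y1p.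
      by rewrite mult_INR ln_mult //; apply: pos_INR_lt.
    - by move=> p /prime_gt0.
  by case.
have -> : INR n * ln 16 = ln (INR (16 ^ n)).
  have e16 : INR 16 = 16 by rewrite /=; lra.
  elim: n => [|n IH]; first by rewrite /= ln_1; ring.
  rewrite expnS mult_INR ln_mult ?e16; [|lra|by apply: pos_INR_lt; rewrite expn_gt0].
  by rewrite -IH S_INR; ring.
have := leq_INR _ _ (primorial_le n); case=> [lt|->]; last exact: Rle_refl.
by apply: Rlt_le; apply: ln_increasing => //; apply: pos_INR_lt; apply: primorial_gt0.
Qed.

(** * Prime sums over exponential ranges *)

Definition leR (x y : R) : bool := Rle_dec x y.
Definition ltR (x y : R) : bool := Rlt_dec x y.

Lemma leRP (x y : R) : reflect (x <= y) (leR x y).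
Proof. by rewrite /leR; case: Rle_dec => h; constructor. Qed.

Lemma ltRP (x y : R) : reflect (x < y) (ltR x y).
Proof. by rewrite /ltR; case: Rlt_dec => h; constructor. Qed.

Lemma sumR_subset (m n : nat) (P Q : pred nat) (F : nat -> R) :
  (forall i, Q i -> 0 <= F i) -> (forall i, (i < m)%N -> P i -> (i < n)%N && Q i) ->
  \sum_(i < m | P i) F i <= \sum_(i < n | Q i) F i.
Proof.
move=> F0 PQ; pose l := maxn m n.
rewrite (big_nat_widen 0 m l) ?leq_maxl // (big_nat_widen 0 n l) ?leq_maxr //.
rewrite big_mkcond [X in _ <= X]big_mkcond /=; apply: sumR_le => i _ _.
case: (boolP (P i && (i < m)%N)) => [/andP[Pi im]|_].
  by have /andP[-> ->] := PQ i im Pi; apply: Rle_refl.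
by case: ifP => [/andP[Qi _]|_]; [apply: F0|apply: Rle_refl].
Qed.

Lemma nat_floor (y : R) : 0 <= y -> exists n : nat, INR n <= y < INR n.+1.
Proof.
move=> y0; have [up1 up2] := archimed y.
have up0 : (0 < up y)%Z by apply: lt_IZR; lra.
exists (Z.to_nat (up y - 1)).
by rewrite S_INR INR_IZR_INZ Z2Nat.id ?minus_IZR; [lra|lia].
Qed.

Definition expitv (i l p : nat) : bool :=
  ltR (exp (INR i)) (INR p) && leR (INR p) (exp (INR l)).

(** [X] truncates to a finite sum: upper bounds hold for every [X], while lower bounds require [X]
    to exceed the right end of the range. With [l = i + 1] this is the sequence [a] of the
    overview. *)
Definition psum (g : nat -> R) (X i l : nat) : R :=
  \sum_(p < X | prime p && expitv i l p) g p * ln (INR p) / INR p.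

Lemma exp_INR_le (i l : nat) : (i <= l)%N -> exp (INR i) <= exp (INR l).
Proof.
move=> /leq_INR [lt|->]; last exact: Rle_refl.
by apply: Rlt_le; apply: exp_increasing.
Qed.

Lemma prime_INR_ge2 (p : nat) : prime p -> 2 <= INR p.
Proof. by move=> /prime_gt1 /leq_INR /=; lra. Qed.

Lemma ln_le_ln (x y : R) : 0 < x -> x <= y -> ln x <= ln y.
Proof.
move=> x0 [xy|->]; last exact: Rle_refl.
by apply: Rlt_le; apply: ln_increasing.
Qed.

Lemma prime_ln_ge0 (p : nat) : prime p -> 0 <= ln (INR p).
Proof. by move=> /prime_INR_ge2 ?; rewrite -ln_1; apply: ln_le_ln; lra. Qed.

Lemma psum_term_ge0 (g : nat -> R) (p : nat) :
  0 <= g p -> prime p -> 0 <= g p * ln (INR p) / INR p.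
Proof.
move=> g0 pp; have := prime_INR_ge2 p pp; have := prime_ln_ge0 p pp => ? ?.
by apply: Rle_mult_inv_pos; [apply: Rmult_le_pos|lra].
Qed.

Lemma psum_ge0 (g : nat -> R) (X i l : nat) : (forall n, 0 <= g n) -> 0 <= psum g X i l.
Proof. by move=> g0; apply: sumR_ge0 => p _ /andP[pp _]; apply: psum_term_ge0. Qed.

(** On the bucket [1 / p] is below [e^(-j)], and Chebyshev bounds the sum of [ln p] by
    [e^(j+1) ln 16]. *)
Lemma psum_bucket_le (g : nat -> R) (B : R) (X j : nat) :
  (forall n, 0 <= g n) -> 0 <= B -> (forall p, prime p -> g p <= B) ->
  psum g X j j.+1 <= B * (exp 1 * ln 16).
Proof.
move=> g0 B0 gB; have ej := exp_pos (INR j).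
have [n [n1 n2]] := nat_floor (exp (INR j.+1)) (Rlt_le _ _ (exp_pos _)).
apply: (Rle_trans _ (B / exp (INR j) * \sum_(p < X | prime p && expitv j j.+1 p) ln (INR p))).
  rewrite sumRMl; apply: sumR_le => p _ /andP[pp /andP[/ltRP pj _]].
  have ? := prime_ln_ge0 p pp.
  have -> : B / exp (INR j) * ln (INR p) = B * ln (INR p) * / exp (INR j) by rewrite /Rdiv; ring.
  apply: Rmult_le_compat.
  - exact: Rmult_le_pos.
  - by apply: Rlt_le; apply: Rinv_0_lt_compat; lra.
  - by apply: Rmult_le_compat_r => //; apply: gB.
  - by apply: Rinv_le_contravar => //; lra.
apply: (Rle_trans _ (B / exp (INR j) * (exp (INR j.+1) * ln 16))); last first.
  by rewrite S_INR exp_plus; apply: Req_le; field; lra.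
apply: Rmult_le_compat_l; first exact: Rle_mult_inv_pos.
apply: (Rle_trans _ (\sum_(p < n.+1 | prime p) ln (INR p))).
  apply: sumR_subset => [p|p _ /andP[-> /andP[_ /leRP pl]]]; first exact: prime_ln_ge0.
  by rewrite andbT; case: leqP => // /leq_INR; lra.
apply: Rle_trans (sum_ln_primes_le n) _; apply: Rmult_le_compat_r => //.
by rewrite -ln_1; apply: ln_le_ln; lra.
Qed.

Lemma psum_cat_le (g : nat -> R) (X i l k : nat) :
  (forall n, 0 <= g n) -> psum g X i k <= psum g X i l + psum g X l k.
Proof.
move=> g0; rewrite /psum big_mkcond [X in _ <= X + _]big_mkcond [X in _ <= _ + X]big_mkcond.
rewrite -sumRD; apply: sumR_le => p _ _.
case: (boolP (prime p)) => [pp|_] /=; last lra.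
have := psum_term_ge0 g p (g0 p) pp.
rewrite /expitv; case: ltRP => h1; case: leRP => h2; case: leRP => h3; case: ltRP => h4 /=; lra.
Qed.

Lemma psum_nil (g : nat -> R) (X i : nat) : psum g X i i = 0.
Proof. by apply: sumR_0 => p _ /andP[_ /andP[/ltRP ? /leRP ?]]; lra. Qed.

Lemma psum_buckets (g : nat -> R) (X i V : nat) : (forall n, 0 <= g n) ->
  psum g X i (i + V) <= \sum_(j < V) psum g X (i + j) (i + j).+1.
Proof.
move=> g0; elim: V => [|V IH]; first by rewrite addn0 psum_nil big_nil; lra.
rewrite big_nat_recr //= addnS.
by have := psum_cat_le g X i (i + V) (i + V).+1 g0; lra.
Qed.

(** * Sums over integers with restricted prime factors *)

(* [X] only makes the sum finite: it is larger than [y] in every use. *)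
Definition Phi (g : nat -> R) (X : nat) (P : nat_pred) (y : R) : R :=
  \sum_(n < X | P.-nat n && leR (INR n) y) g n.

Lemma Phi_ge0 (g : nat -> R) (X : nat) (P : nat_pred) (y : R) :
  (forall n, 0 <= g n) -> 0 <= Phi g X P y.
Proof. by move=> g0; apply: sumR_ge0. Qed.

Lemma Phi_mono (g : nat -> R) (X : nat) (P P' : nat_pred) (y y' : R) :
  (forall n, 0 <= g n) -> {subset P <= P'} -> y <= y' -> Phi g X P y <= Phi g X P' y'.
Proof.
move=> g0 PP yy; apply: sumR_subset => // n nX /andP[Pn /leRP ny].
rewrite nX /=; apply/andP; split; last by apply/leRP; lra.
by apply: sub_in_pnat Pn => p _; apply: PP.
Qed.

(* The factorisation [n = q * m] is recovered from [n] as its [P^']- and [P]-parts. *)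
Lemma Phi_split (g : nat -> R) (X : nat) (P P' : nat_pred) (Q : pred nat) (y : R) :
  multiplicative g -> (forall n, 0 <= g n) -> y < INR X ->
  (forall q, Q q -> q = 1%N \/ [/\ prime q, q \notin P & q \in P']) ->
  {subset P <= P'} ->
  \sum_(q < X | Q q) g q * Phi g X P (y / INR q) <= Phi g X P' y.
Proof.
move=> [_ gM] g0 yX QP PP.
have Qnat q : Q q -> [/\ (0 < q)%N, P^'.-nat q & P'.-nat q].
  case/QP=> [->|[pq qP qP']]; first by split.
  by split; [exact: prime_gt0| |]; rewrite pnatE.
pose D q m := [&& Q q, P.-nat m & leR (INR m) (y / INR q)].
have Dprop q m : D q m -> [/\ (q * m < X)%N, P'.-nat (q * m)%N, INR (q * m) <= y,
    ((q * m)`_P^')%N = q & ((q * m)`_P)%N = m].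
  move=> /and3P[/Qnat[q0 Pq P'q] Pm /leRP my].
  have m0 : (0 < m)%N by case/andP: Pm.
  have rq := pos_INR_lt q q0.
  have qmy : INR (q * m) <= y.
    have -> : y = INR q * (y / INR q) by field; lra.
    by rewrite mult_INR; apply: Rmult_le_compat_l; lra.
  split=> //.
  - by case: leqP => // /leq_INR; lra.
  - by rewrite pnatM P'q (sub_in_pnat _ Pm) // => p _; apply: PP.
  - by rewrite partnM // part_pnat_id // part_p'nat ?pnatNK // muln1.
  - by rewrite partnM // part_p'nat // part_pnat_id // mul1n.
(* The left side becomes a triple sum of [T], in which each [n] admits at most one pair [(q, m)]. *)
pose T n q m := if D q m && (n == q * m)%N then g n else 0.
have -> : \sum_(q < X | Q q) g q * Phi g X P (y / INR q) =
    \sum_(n < X) \sum_(q < X) \sum_(m < X) T n q m.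
  rewrite [RHS]sumR_exchange big_mkcond; apply: sumR_eq => q qX _.
  rewrite [RHS]sumR_exchange; case: (boolP (Q q)) => Qq; last first.
    by apply: esym; apply: sumR_0 => m _ _; apply: sumR_0 => n _ _; rewrite /T /D (negbTE Qq).
  rewrite /Phi sumRMl big_mkcond; apply: sumR_eq => m mX _.
  case: ifP => [Hm|Hm]; last first.
    by apply: esym; apply: sumR_0 => n _ _; rewrite /T /D Qq Hm.
  have Dqm : D q m by rewrite /D Qq Hm.
  have [qmX _ _ _ _] := Dprop q m Dqm.
  rewrite -gM; last first.
    by have [_ Pq _] := Qnat q Qq; case/andP: Hm => Pm _; apply: p'nat_coprime Pq Pm.
  rewrite (bigD1_seq (q * m)%N) ?iota_uniq ?mem_index_iota //=.
  rewrite big1 ?Rplus_0_r; first by rewrite /T Dqm eqxx.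
  by move=> n /negbTE nqm; rewrite /T Dqm nqm.
rewrite /Phi [X in _ <= X]big_mkcond; apply: sumR_le => n _ _.
case: ifP => Hn; last first.
  apply: Req_le; apply: sumR_0 => q _ _; apply: sumR_0 => m _ _; rewrite /T.
  case: ifP => // /andP[/Dprop[_ H1 H2 _ _] /eqP E].
  by rewrite E H1 in Hn; case: leRP Hn.
have Tn q m : T n q m <> 0 -> q = (n`_P^')%N /\ m = (n`_P)%N.
  by rewrite /T; case: ifP => // /andP[/Dprop[_ _ _ H1 H2] /eqP ->]; rewrite H1 H2.
have inner q : \sum_(m < X) T n q m <> 0 -> q = (n`_P^')%N.
  move=> ne; apply: NNPP => nq; apply: ne; apply: sumR_0 => m _ _.
  by apply: NNPP => /Tn [? _].
apply: sumR_disjoint_le => // [q|q q' /andP[qq' _]].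
  apply: sumR_disjoint_le => // [m|m m' /andP[mm' _]].
    by rewrite /T; case: ifP => _; [apply: Rle_refl|apply: g0].
  case: (Req_dec (T n q m) 0) => [|/Tn[_ E]]; first by left.
  case: (Req_dec (T n q m') 0) => [|/Tn[_ E']]; first by right.
  by lia.
case: (Req_dec (\sum_(m < X) T n q m) 0) => [|/inner E]; first by left.
case: (Req_dec (\sum_(m < X) T n q' m) 0) => [|/inner E']; first by right.
by lia.
Qed.

(** * The sums of the statement as iterated sums, and the density hypothesis on exponential
    ranges *)

Lemma fold_le_bigop (idx : R) (op : Monoid.com_law idx) (x : R) (P : pred nat)
    (f : nat -> R) (X : nat) : x < INR X ->
  fold_right op idx (List.map (fun n => if P n && Rle_dec (INR n) x then f n else idx)
         (List.seq 1 (Z.to_nat (up x)))) =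
  \big[op/idx]_(0 <= n < X | [&& (0 < n)%N, P n & leR (INR n) x]) f n.
Proof.
move=> xX; set u := Z.to_nat (up x).
have xu : x < INR u.
  have [up1 _] := archimed x; apply: Rlt_le_trans up1 _.
  by rewrite INR_IZR_INZ; apply: IZR_le; lia.
have fold_big (F : nat -> R) s :
    fold_right op idx (List.map F s) = \big[op/idx]_(i <- s) F i.
  by elim: s => [|n s IH]; rewrite ?big_nil ?big_cons //= IH.
have seqE m n : List.seq m n = iota m n by elim: n m => //= n IH m; rewrite IH.
have -> : List.seq 1 u = index_iota 1 u.+1 by rewrite seqE /index_iota subn1.
rewrite fold_big -big_mkcond /=.
have -> : \big[op/idx]_(1 <= i < u.+1 | P i && Rle_dec (INR i) x) f i =
   \big[op/idx]_(0 <= n < u.+1 | [&& (0 < n)%N, P n & leR (INR n) x]) f n.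
  rewrite [RHS]big_mkcond big_ltn //= Monoid.mul1m -[RHS]big_mkcond.
  rewrite big_nat_cond [RHS]big_nat_cond; apply: eq_bigl => n.
  by rewrite /leR; case: (ltnP 0 n).
pose l := maxn u.+1 X.
rewrite (big_nat_widen 0 u.+1 l) ?leq_maxl // (big_nat_widen 0 X l) ?leq_maxr //.
apply: eq_bigl => n; case: leRP => nx; rewrite ?andbF //.
have -> : (n < u.+1)%N by rewrite ltnS; case: leqP => // /ltnW /leq_INR; lra.
by have -> : (n < X)%N by case: leqP => // /leq_INR; lra.
Qed.

Lemma rsum_leE (x : R) (P : pred nat) (f : nat -> R) (X : nat) : x < INR X ->
  rsum_le x P f = \sum_(n < X | [&& (0 < n)%N, P n & leR (INR n) x]) f n.
Proof. exact: fold_le_bigop. Qed.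

Lemma rprod_primes_leE (x : R) (f : nat -> R) (X : nat) : x < INR X ->
  rprod_primes_le x f =
  \big[Rmult/1]_(0 <= p < X | [&& (0 < p)%N, prime p & leR (INR p) x]) f p.
Proof. exact: (fold_le_bigop 1). Qed.

(** The hypothesis is used at [x = e^(i+V)] with [b = 1 - 1 / r], where [r] is chosen so that
    [(x^b, x]] lies inside [(e^i, e^(i+V)]] and still has logarithmic length at least [2 V / 3].
    Taking [eps = c / 2] leaves the constant [c / 3]. *)
Lemma density_lower (g : nat -> R) (c : R) :
  (forall n, 0 <= g n) -> 0 < c ->
  (forall b : R, 0 < b < 1 ->
     forall eps : R, 0 < eps -> exists X : R, forall x : R, X <= x ->
       c - eps <=
         / ((1 - b) * ln x) *
           rsum_le x (fun p => prime p && Rlt_dec (Rpower x b) (INR p))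
                     (fun p => g p * ln (INR p) / INR p)) ->
  forall G : nat, exists V0 : nat, forall V i X : nat,
    (V0 <= V)%N -> (V <= i)%N -> (i + V <= G * V)%N -> exp (INR (i + V)) < INR X ->
    c / 3 * INR V <= psum g X i (i + V).
Proof.
move=> g0 c0 hyp G.
(* The threshold in the hypothesis depends on [b]; only finitely many [r] occur, so a maximum of
   thresholds serves for all. *)
have [X0 HX0] : exists X0 : R, forall r : nat, (1 < r <= G)%N -> forall x : R, X0 <= x ->
    c / 2 <= / (/ INR r * ln x) *
      rsum_le x (fun p => prime p && Rlt_dec (Rpower x (1 - / INR r)) (INR p))
                (fun p => g p * ln (INR p) / INR p).
  elim: G => [|G [X1 IH]]; first by exists 0 => r; lia.
  case: (ltnP 0 G) => G0; last by exists 0 => r; lia.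
  have G1 : 1 < INR G.+1 by rewrite S_INR; have := pos_INR_lt G G0; lra.
  have G2 : / INR G.+1 < 1 by rewrite -Rinv_1; apply: Rinv_lt_contravar; lra.
  have G3 : 0 < / INR G.+1 by apply: Rinv_0_lt_compat; lra.
  have [||X2 H2] := hyp (1 - / INR G.+1) _ (c / 2); [lra|lra|].
  exists (Rmax X1 X2) => r rG x xX.
  have xX1 := Rle_trans _ _ _ (Rmax_l X1 X2) xX.
  have xX2 := Rle_trans _ _ _ (Rmax_r X1 X2) xX.
  case: (ltnP r G.+1) => rG'; first by apply: IH => //; lia.
  have -> : r = G.+1 by lia.
  have := H2 x xX2; have -> : 1 - (1 - / INR G.+1) = / INR G.+1 by ring.
  lra.
have [V0 HV0] : exists V0 : nat, X0 <= INR V0.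
  have [n [_ Hn]] := nat_floor (Rabs X0) (Rabs_pos _).
  by exists n.+1; have := Rle_abs X0; lra.
exists V0.+1 => V i X VV Vi iVG eX.
(* The ceiling of [(i + V) / V]: it is the least [r] with [(i + V) / r <= V], that is, with
   [x^b >= e^i]. *)
pose r := ((i + V).-1 %/ V).+1.
have V1 : (0 < V)%N by lia.
have rlo : (i + V <= r * V)%N.
  by have := ltn_ceil (i + V).-1 V1; rewrite /r; lia.
have rhi : (r * V < i + V + V)%N.
  by have := leq_trunc_div (i + V).-1 V; rewrite /r mulSn; lia.
have r1 : (1 < r)%N.
  by rewrite ltnNge; apply/negP => r1; have : (r * V <= 1 * V)%N by [rewrite leq_mul2r r1 orbT]; lia.
have rG : (r <= G)%N.
  by rewrite leqNgt; apply/negP => rG; have : (G.+1 * V <= r * V)%N by [rewrite leq_mul2r rG orbT]; lia.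
have rV := pos_INR_lt V V1.
have rr : 0 < INR r by apply: pos_INR_lt; lia.
have riV : 0 < INR (i + V) by apply: pos_INR_lt; lia.
set x := exp (INR (i + V)) in eX.
have := HX0 r _ x; rewrite r1 rG => /(_ isT).
have -> : ln x = INR (i + V) by rewrite /x ln_exp.
have xX0 : X0 <= x.
  apply: Rle_trans HV0 _; have := exp_ineq1_le (INR (i + V)).
  have V0i : (V0 <= i + V)%N by lia.
  by have := leq_INR _ _ V0i; rewrite -/x; lra.
move=> /(_ xX0) H.
(* From [r V < i + 2 V] and [V <= i] follows [2 r V <= 3 (i + V)]. *)
have Hlo : c / 3 * INR V <= c / 2 * (/ INR r * INR (i + V)).
  have -> : c / 2 * (/ INR r * INR (i + V)) = c / 3 * (3 * INR (i + V) / (2 * INR r)).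
    by field; lra.
  apply: Rmult_le_compat_l; first lra.
  apply: (Rmult_le_reg_r (2 * INR r)); first lra.
  have -> : 3 * INR (i + V) / (2 * INR r) * (2 * INR r) = 3 * INR (i + V) by field; lra.
  have : (V * (2 * r) <= 3 * (i + V))%N by lia.
  by move=> /leq_INR; rewrite !mult_INR /=; lra.
apply: Rle_trans Hlo _.
set s := rsum_le _ _ _ in H.
apply: (Rle_trans _ s).
  have pos : 0 < / INR r * INR (i + V) by apply: Rmult_lt_0_compat => //; apply: Rinv_0_lt_compat.
  have -> : s = / (/ INR r * INR (i + V)) * s * (/ INR r * INR (i + V)) by field; lra.
  by apply: Rmult_le_compat_r => //; lra.
rewrite /s (rsum_leE _ _ _ X) //.
apply: sumR_subset => [p /andP[pp _]|p pX /and3P[_ /andP[pp pl] /leRP pu]].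
  exact: psum_term_ge0.
rewrite pX pp /expitv /=; apply/andP; split; last exact/leRP.
apply/ltRP; case: Rlt_dec pl => // pl _; apply: Rle_lt_trans pl.
rewrite /Rpower /x ln_exp.
suff : INR i <= (1 - / INR r) * INR (i + V).
  by case=> [?|->]; [apply: Rlt_le; apply: exp_increasing|apply: Rle_refl].
suff : / INR r * INR (i + V) <= INR V by rewrite plus_INR; lra.
apply: (Rmult_le_reg_l (INR r)) => //.
have -> : INR r * (/ INR r * INR (i + V)) = INR (i + V) by field; lra.
by rewrite -mult_INR; apply: leq_INR.
Qed.

(** * Counting products of primes from successive ranges *)

Lemma bucket_sum_ge (g : nat -> R) (X j N : nat) : (forall n, 0 <= g n) -> (j < N)%N ->
  psum g X j j.+1 * (exp (INR j) / INR N) <=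
  \sum_(p < X | prime p && expitv j j.+1 p) g p.
Proof.
move=> g0 jN; have rN : 0 < INR N by apply: pos_INR_lt; lia.
rewrite /psum sumRMr; apply: sumR_le => p _ /andP[pp /andP[/ltRP pl /leRP pu]].
have p2 := prime_INR_ge2 p pp; have lp := prime_ln_ge0 p pp; have ej := exp_pos (INR j).
have lpN : ln (INR p) <= INR N.
  rewrite -(ln_exp (INR N)); apply: ln_le_ln; first lra.
  by apply: Rle_trans pu _; apply: exp_INR_le.
(* Regrouped so that both factors [ln p / N] and [e^j / p] are at most 1. *)
have -> : g p * ln (INR p) / INR p * (exp (INR j) / INR N) =
    g p * ((ln (INR p) / INR N) * (exp (INR j) / INR p)) by field; lra.
rewrite -[X in _ <= X]Rmult_1_r; apply: Rmult_le_compat_l => //.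
rewrite -[X in _ <= X](Rmult_1_r 1); apply: Rmult_le_compat.
- exact: Rle_mult_inv_pos.
- by apply: Rle_mult_inv_pos; lra.
- by apply: (Rmult_le_reg_r (INR N)) => //; field_simplify; lra.
- by apply: (Rmult_le_reg_r (INR p)); [lra|field_simplify; lra].
Qed.

Lemma sum_buckets_le (X b V : nat) (F : nat -> R) : (forall p, 0 <= F p) ->
  \sum_(j < V) \sum_(p < X | prime p && expitv (b + j) (b + j).+1 p) F p <=
  \sum_(p < X | prime p && expitv b (b + V) p) F p.
Proof.
move=> F0; elim: V => [|V IH]; first by rewrite big_nil; apply: sumR_ge0 => p _ _.
rewrite big_nat_recr //= addnS; apply: Rle_trans (Rplus_le_compat_r _ _ _ IH) _.
rewrite [X in X + _]big_mkcond [X in _ + X]big_mkcond [X in _ <= X]big_mkcond -sumRD.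
apply: sumR_le => p _ _; have Fp := F0 p.
have e1 := exp_INR_le _ _ (leqnSn (b + V)); have e2 := exp_INR_le _ _ (leq_addr V b).
case: (prime p) => /=; last lra.
rewrite /expitv.
case: (ltRP (exp (INR b))) => ?; case: (ltRP (exp (INR (b + V)))) => ?;
case: (leRP _ (exp (INR (b + V)))) => ?; case: (leRP _ (exp (INR (b + V).+1))) => ? /=; lra.
Qed.

(** One prime from [(e^b, e^(b+V)]] is multiplied in; it is coprime to the rest because [P] stops at
    [e^b]. Replacing a prime of bucket [b + j] by [e^(b+j+1)] turns division of [y] into the
    translation [sh j] and costs one unit of exponent, which [t] records. Replacing the weight 1 by
    [ln p / p] costs the factor [N]. *)
Lemma Phi_step (g : nat -> R) (X N V s t b : nat) (P P' : nat_pred) (d : R) (F : nat -> R) :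
  multiplicative g -> (forall n, 0 <= g n) ->
  (forall p, p \in P -> INR p <= exp (INR b)) -> {subset P <= P'} ->
  (forall p, prime p -> expitv b (b + V) p -> p \in P') -> (b + V <= N)%N ->
  (forall n, exp (INR (s + n + t)) < INR X ->
     d * exp (INR (s + n)) * F n <= Phi g X P (exp (INR (s + n + t)))) ->
  forall n, exp (INR (s + b + n + t.+1)) < INR X ->
    d / INR N * exp (INR (s + b + n)) *
       (\sum_(j < V) psum g X (b + j) (b + j).+1 * sh j F n)
    <= Phi g X P' (exp (INR (s + b + n + t.+1))).
Proof.
move=> gM g0 Pb PP bP' bVN IH n yX; set y := exp _ in yX *.
pose Q p := prime p && expitv b (b + V) p.
have QP q : Q q -> q = 1%N \/ [/\ prime q, q \notin P & q \in P'].
  move=> /andP[pq iq]; right; split=> //; last exact: bP'.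
  by apply/negP => /Pb; case/andP: iq => /ltRP; lra.
apply: Rle_trans (Phi_split g X P P' Q y gM g0 yX QP PP).
have P0 z := Phi_ge0 g X P z g0.
apply: Rle_trans (sum_buckets_le X b V (fun q => g q * Phi g X P (y / INR q)) _); last first.
  by move=> p; apply: Rmult_le_pos.
rewrite sumRMl; apply: sumR_le => j jV _.
have bjN : (b + j < N)%N by lia.
have rN : 0 < INR N by apply: pos_INR_lt; lia.
rewrite /sh; case: leqP => jn; last first.
  rewrite !Rmult_0_r; apply: sumR_ge0 => p _ _; exact: Rmult_le_pos.
pose z := exp (INR (s + (n - j) + t)).
apply: (Rle_trans _ ((\sum_(p < X | prime p && expitv (b + j) (b + j).+1 p) g p) * Phi g X P z)); last first.
  rewrite sumRMr; apply: sumR_le => p _ /andP[pp /andP[_ /leRP pu]].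
  apply: Rmult_le_compat_l => //; apply: Phi_mono => //.
  have p2 := prime_INR_ge2 p pp.
  apply: (Rmult_le_reg_r (INR p)); first lra.
  have -> : y / INR p * INR p = y by field; lra.
  have -> : y = z * exp (INR (b + j).+1).
    by rewrite /y /z -exp_plus -plus_INR; congr (exp (INR _)); lia.
  by apply: Rmult_le_compat_l => //; apply: Rlt_le; apply: exp_pos.
have zX : z < INR X.
  by apply: Rle_lt_trans yX; apply: exp_INR_le; lia.
apply: Rle_trans (Rmult_le_compat_r _ _ _ (P0 z) (bucket_sum_ge g X (b + j) N g0 bjN)).
have A0 := psum_ge0 g X (b + j) (b + j).+1 g0; have e0 := exp_pos (INR (b + j)).
have AN : 0 <= psum g X (b + j) (b + j).+1 * (exp (INR (b + j)) / INR N).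
  by apply: Rmult_le_pos => //; apply: Rle_mult_inv_pos; lra.
apply: Rle_trans (Rmult_le_compat_l _ _ _ AN (IH (n - j)%N zX)).
have -> : exp (INR (s + b + n)) = exp (INR (b + j)) * exp (INR (s + (n - j))).
  by rewrite -exp_plus -plus_INR; congr (exp (INR _)); lia.
by apply: Req_le; field; lra.
Qed.

(** Uniform density on an interval of length [L]; convolution with it gives the smooth start of the
    iteration. *)
Definition box (L n : nat) : R := if (n < L)%N then / INR L else 0.

Lemma sum_box (L M : nat) : (0 < L <= M)%N -> \sum_(n < M) box L n = 1.
Proof.
move=> /andP[L0 LM]; rewrite (sumR_widen L M) //; last first.
  by move=> i; rewrite /box ltnNge => ->.
transitivity (\sum_(n < L) / INR L); first by apply: sumR_eq => i iL _; rewrite /box iL.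
by rewrite sumR_const; have := pos_INR_lt L L0 => ?; field; lra.
Qed.

Lemma box_ge0 (L n : nat) : 0 <= box L n.
Proof.
rewrite /box; case: ltnP => nL; last lra.
by apply: Rlt_le; apply: Rinv_0_lt_compat; apply: pos_INR_lt; lia.
Qed.

Lemma sum_sh_box_le (W L n : nat) : (0 < L)%N -> 0 <= \sum_(j < W) sh j (box L) n <= 1.
Proof.
move=> L0; split.
  by apply: sumR_ge0 => j _ _; rewrite /sh; case: leqP => _; [apply: box_ge0|lra].
apply: (Rle_trans _ (\sum_(j < n.+1) box L (n - j))).
  rewrite /sh -big_mkcond /=.
  by apply: sumR_subset => [i _|i _ ?]; [apply: box_ge0|rewrite andbT ltnS].
rewrite big_nat_rev /= add0n.
have -> : \sum_(j < n.+1) box L (n - (n.+1 - j.+1)) = \sum_(j < n.+1) box L j.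
  by apply: sumR_eq => j jn _; congr box; lia.
rewrite -(sum_box L (maxn L n.+1)); last by rewrite L0 leq_maxl.
by apply: sumR_sub_le; [rewrite leq_maxr|apply: box_ge0].
Qed.

Lemma sumR_delta (W m : nat) (A : nat -> R) (C : R) : (forall j, 0 <= A j <= C) ->
  0 <= \sum_(j < W) (if j == m then A j else 0) <= C.
Proof.
move=> AC; split; first by apply: sumR_ge0 => j _ _; have [? _] := AC j; case: eqP => _ //; lra.
apply: sumR_disjoint_le.
- by have := AC 0%N; lra.
- by move=> j; have := AC j; case: eqP => _; lra.
- move=> i j ij; case: eqP => [im|_]; last by left.
  by case: eqP => [jm|_]; [exfalso; lia|right].
Qed.

(** For the increments, only the two ends of the box survive: with [A] read as 0 outside [[0, W)],
    the difference is [(A n - A (n - L)) / L], and both values lie in [[0, C]]. *)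
Lemma box_conv_props (W L : nat) (C : R) (A : nat -> R) : (0 < L)%N -> 0 <= C ->
  (forall j, 0 <= A j <= C) ->
  let f n := \sum_(j < W) A j * sh j (box L) n in
  [/\ forall n, 0 <= f n <= C, forall n, (W + L <= n)%N -> f n = 0,
      forall n, Rabs (f n - sh 1 f n) <= C / INR L
    & forall M, (W + L <= M)%N -> \sum_(n < M) f n = \sum_(j < W) A j].
Proof.
move=> L0 C0 AC f; have rL := pos_INR_lt L L0.
have boxL n : (L <= n)%N -> box L n = 0 by rewrite /box ltnNge => ->.
have sb j n : 0 <= sh j (box L) n.
  by rewrite /sh; case: leqP => _; [apply: box_ge0|lra].
split=> [n|n nW|n|M WM].
- split; first by apply: sumR_ge0 => j _ _; apply: Rmult_le_pos; [have := AC j; lra|].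
  apply: (Rle_trans _ (C * \sum_(j < W) sh j (box L) n)).
    by rewrite sumRMl; apply: sumR_le => j _ _; apply: Rmult_le_compat_r => //; have := AC j; lra.
  rewrite -[X in _ <= X]Rmult_1_r; apply: Rmult_le_compat_l => //.
  by have := sum_sh_box_le W L n L0; lra.
- by apply: sumR_0 => j jW _; rewrite (sh_supp L) // ?Rmult_0_r //; lia.
- have -> : f n - sh 1 f n = / INR L * ((\sum_(j < W) (if j == n then A j else 0)) -
      \sum_(j < W) (if (j + L == n)%N then A j else 0)).
    have -> : sh 1 f n = \sum_(j < W) A j * sh (j + 1) (box L) n.
      rewrite {1}/sh; case: (leqP 1 n) => n1.
        by apply: sumR_eq => j _ _; rewrite -sh_sh /(sh 1) n1.
      by apply: esym; apply: sumR_0 => j _ _; rewrite /sh addn1 leqNgt ltnS (leq_trans _ (leq0n j)) ?Rmult_0_r //; lia.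
    rewrite -sumRB -sumRB sumRMl; apply: sumR_eq => j _ _; rewrite /sh /box.
    case: (leqP j n) => ?; case: (leqP (j + 1) n) => ?; case: (ltnP (n - j) L) => ?;
      case: (ltnP (n - (j + 1)) L) => ?; case: eqP => ?; case: eqP => ?;
      try (exfalso; lia); ring.
  rewrite Rabs_mult Rabs_pos_eq; last by apply: Rlt_le; apply: Rinv_0_lt_compat.
  rewrite Rmult_comm; apply: Rmult_le_compat_r.
    by apply: Rlt_le; apply: Rinv_0_lt_compat.
  have d1 := sumR_delta W n A C AC.
  have d2 : 0 <= \sum_(j < W) (if (j + L == n)%N then A j else 0) <= C.
    case: (leqP L n) => Ln.
      have := sumR_delta W (n - L) A C AC.
      suff -> : \sum_(j < W) (if j == (n - L)%N then A j else 0) =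
        \sum_(j < W) (if (j + L == n)%N then A j else 0) by [].
      by apply: sumR_eq => j _ _; congr (if _ then _ else _); lia.
    by rewrite sumR_0; [lra|move=> j _ _; case: eqP => //; lia].
  by apply: Rabs_le; lra.
- rewrite sumR_exchange; apply: sumR_eq => j jW _.
  rewrite -sumRMl (sum_sh M L) //; last lia.
  by rewrite sum_box ?Rmult_1_r //; lia.
Qed.

Lemma Phi_ge1 (g : nat -> R) (X : nat) (P : nat_pred) (y : R) :
  multiplicative g -> (forall n, 0 <= g n) -> 1 <= y < INR X -> 1 <= Phi g X P y.
Proof.
move=> [g1 _] g0 [y1 yX].
have X1 : (1 < X)%N by case: leqP => // /leq_INR /=; lra.
apply: (Rle_trans _ (\sum_(n < X | n == 1%N) g n)).
  by rewrite big_nat1_eq X1 /= g1; lra.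
apply: sumR_subset => // n nX /eqP n1; rewrite nX n1 /=.
exact/leRP.
Qed.

(* The factor of index [0] is taken beyond [e^V] and the one of index [i.+1] beyond
   [e^(V + W + i * V)]; [offset V W k] adds up these exponents. *)
Fixpoint offset (V W k : nat) : nat :=
  (if k is k'.+1 then offset V W k' + (V + W + k' * V) else V)%N.

(** The sequence [f_0] of the overview. The bucket sums themselves may jump, hence the
    convolution. *)
Definition start_density (g : nat -> R) (X V W L n : nat) : R :=
  \sum_(j < W) psum g X (V + j) (V + j).+1 * sh j (box L) n.

(** The ranges for successive [k] are adjacent and lie beyond the range of [start_density], so the
    chosen primes are distinct. *)
Definition step_density (g : nat -> R) (X V W k j : nat) : R :=
  psum g X (V + W + k * V + j) (V + W + k * V + j).+1.

Lemma smoothed_ge0 (V : nat) (a : nat -> nat -> R) (f0 : nat -> R) (k : nat) :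
  (forall i j, 0 <= a i j) -> (forall n, 0 <= f0 n) ->
  (forall i, (i < k)%N -> 0 < \sum_(j < V) a i j) -> forall n, 0 <= smoothed V a f0 k n.
Proof.
move=> a0 f00; elim: k => [|k IH] A0 n //=.
apply: sumR_ge0 => j _ _; apply: Rmult_le_pos.
  by apply: Rle_mult_inv_pos => //; apply: A0.
rewrite /sh; case: leqP => _; last lra.
by apply: IH => i ik; apply: A0; lia.
Qed.

(** Iteration of [Phi_step], starting from the integer 1 alone. Each further step costs [1 / N] and
    gains the normalising sum in [smoothed], which is at least [gam V]; this produces the power of
    [gam V / N]. The summand [k + 1] counts the primes used, one unit of exponent each. *)
Lemma Phi_chain (g : nat -> R) (X V W L N : nat) (gam : R) (k : nat) :
  multiplicative g -> (forall n, 0 <= g n) -> 0 < gam -> (0 < L)%N -> (0 < V)%N ->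
  (V + W + k * V <= N)%N ->
  (forall i, (i < k)%N -> gam * INR V <= \sum_(j < V) step_density g X V W i j) ->
  forall n, exp (INR (offset V W k + n + k.+1)) < INR X ->
    exp (- INR L) / INR N * (gam * INR V / INR N) ^ k * exp (INR (offset V W k + n)) *
      smoothed V (step_density g X V W) (start_density g X V W L) k n
    <= Phi g X [pred p | expitv V (V + W + k * V) p] (exp (INR (offset V W k + n + k.+1))).
Proof.
move=> gM g0 gam0 L0 V0; have rL := pos_INR_lt L L0; have rV := pos_INR_lt V V0.
elim: k => [|k IH] kN Alo n yX.
  rewrite mul0n addn0 in kN *; rewrite /= Rmult_1_r.
  apply: (Phi_step g X N W 0 0 V pred0 _ (exp (- INR L)) (box L)) => //.
  (* The factor [exp (- L)] makes the required bound at most 1 on the support [m < L] of the box, so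
     the term [n = 1] suffices. *)
  move=> m mX; rewrite add0n addn0 in mX *.
  have e1 : 1 <= exp (INR m) by have := exp_ineq1_le (INR m); have := pos_INR m; lra.
  rewrite /box; case: ltnP => mL; last first.
    by rewrite Rmult_0_r; apply: Phi_ge0.
  apply: Rle_trans (Phi_ge1 g X pred0 (exp (INR m)) gM g0 (conj e1 mX)).
  rewrite -exp_plus -[X in _ <= X](Rmult_1_r 1); apply: Rmult_le_compat.
  - by apply: Rlt_le; apply: exp_pos.
  - by apply: Rlt_le; apply: Rinv_0_lt_compat.
  - rewrite -exp_0; apply: Rlt_le; apply: exp_increasing.
    have : INR m < INR L by apply: lt_INR; lia.
    lra.
  - rewrite -Rinv_1; apply: Rinv_le_contravar; first lra.
    by have := leq_INR _ _ L0; rewrite /=; lra.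
have rN : 0 < INR N by apply: pos_INR_lt; lia.
have {}IH := IH _ (fun i ik => Alo i (ltnW ik)).
set f := smoothed V _ _ k in IH.
pose b := (V + W + k * V)%N.
have step := Phi_step g X N V (offset V W k) k.+1 b [pred p | expitv V b p]
  [pred p | expitv V (V + W + k.+1 * V) p]
  (exp (- INR L) / INR N * (gam * INR V / INR N) ^ k) f gM g0.
have A0 i : (i < k.+1)%N -> 0 < \sum_(j < V) step_density g X V W i j.
  by move=> /Alo; nra.
have a0 i j : 0 <= step_density g X V W i j by apply: psum_ge0.
have f0 n' : 0 <= start_density g X V W L n'.
  apply: sumR_ge0 => j _ _; apply: Rmult_le_pos; first exact: psum_ge0.
  by rewrite /sh; case: leqP => _; [apply: box_ge0|lra].
have s0 := smoothed_ge0 V (step_density g X V W) (start_density g X V W L) k.+1 a0 f0 A0 n.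
set A := \sum_(j < V) step_density g X V W k j.
have sE : \sum_(j < V) psum g X (b + j) (b + j).+1 * sh j f n =
    A * smoothed V (step_density g X V W) (start_density g X V W L) k.+1 n.
  rewrite -[smoothed _ _ _ k.+1 n]/(\sum_(j < V) (step_density g X V W k j / A) * sh j f n).
  rewrite sumRMl; apply: sumR_eq => j _ _; rewrite /step_density -/b.
  by have := A0 k (ltnSn k); rewrite -/A => ?; field; lra.
apply: Rle_trans (step _ _ _ _ _ n _) => //; last first.
- by move=> m mX; apply: IH => //; lia.
- by rewrite /b; lia.
- move=> p pp; rewrite !inE /expitv => /andP[/ltRP pl /leRP pu]; apply/andP; split.
    by apply/ltRP; apply: Rle_lt_trans pl; apply: exp_INR_le; rewrite /b; lia.
  by apply/leRP; apply: Rle_trans pu _; apply: exp_INR_le; rewrite /b; lia.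
- move=> p; rewrite !inE /expitv => /andP[-> /leRP pu] /=.
  by apply/leRP; apply: Rle_trans pu _; apply: exp_INR_le; rewrite /b; lia.
- by move=> p; rewrite inE => /andP[_ /leRP].
rewrite sE; set e := exp (INR _); set F := smoothed _ _ _ _ _ in s0 *.
have e0 : 0 < e := exp_pos _.
have gA : gam * INR V <= A by apply: Alo.
set d := exp (- INR L) / INR N * _ ^ k.
have d0 : 0 <= d.
  apply: Rmult_le_pos; first by apply: Rle_mult_inv_pos => //; apply: Rlt_le; apply: exp_pos.
  by apply: pow_le; apply: Rle_mult_inv_pos => //; nra.
have -> : exp (- INR L) / INR N * (gam * INR V / INR N) ^ k.+1 * e * F =
  (d / INR N * e * F) * (gam * INR V) by rewrite /d /=; field; lra.
have -> : d / INR N * e * (A * F) = (d / INR N * e * F) * A by ring.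
apply: Rmult_le_compat_l => //; apply: Rmult_le_pos => //.
by apply: Rmult_le_pos; [apply: Rle_mult_inv_pos|lra].
Qed.

(** * Integers free of small prime factors *)

Lemma offset_bounds (V w k : nat) :
  (V <= offset V (w * V) k <= (1 + k * (1 + w + k)) * V)%N.
Proof. by elim: k => [|k IH] /=; [lia|nia]. Qed.

Lemma nat_above (y : R) : exists n : nat, y < INR n.
Proof.
have [n [_ Hn]] := nat_floor (Rabs y) (Rabs_pos _).
by exists n.+1; have := Rle_abs y; lra.
Qed.

Lemma sum_blocks_ge (A : nat -> R) (gam : R) (V w : nat) :
  (forall m, (m < w)%N -> gam * INR V <= \sum_(j < V) A (m * V + j)%N) ->
  gam * INR (w * V) <= \sum_(j < w * V) A j.
Proof.
elim: w => [|w IH] H; first by rewrite mul0n big_nil /=; lra.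
rewrite mulSn addnC (big_cat_nat (n := (w * V)%N)) ?leq_addr //= plus_INR.
rewrite -{3}[(w * V)%N]add0n big_addn addKn.
have -> : \sum_(j < V) A (j + w * V)%N = \sum_(j < V) A (w * V + j)%N.
  by apply: sumR_eq => j _ _; rewrite addnC.
have := IH (fun m mw => H m (ltnW mw)); have := H w (ltnSn w); lra.
Qed.

(** At [n0 + V - 1] the translates sample [f] exactly on [[n0, n0 + V)]. Replacing these values by
    [f n0] gives at least [gam V f n0] and an error of at most half of that; finally
    [f n0 >= gam / 4]. *)
Lemma flat_convolution_ge (V n0 : nat) (C gam : R) (A f : nat -> R) :
  (0 < V)%N -> 0 < gam -> 0 < C -> (forall j, 0 <= A j <= C) ->
  gam * INR V <= \sum_(j < V) A j -> gam / 4 <= f n0 ->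
  \sum_(r < V) Rabs (f (n0 + r)%N - f n0) <= gam / (2 * C) * INR V * f n0 ->
  gam ^ 2 / 8 * INR V <= \sum_(j < V) A j * sh j f (n0 + V.-1).
Proof.
move=> V0 g0 C0 AC Alo fn flat; have rV := pos_INR_lt V V0.
apply: (Rle_trans _ (\sum_(j < V) (A j * f n0 - C * Rabs (f (n0 + (0 + V - j.+1))%N - f n0)))).
  rewrite sumRB -sumRMr -sumRMl.
  have := big_nat_rev Rplus 0 0%N V xpredT (fun r => Rabs (f (n0 + r)%N - f n0)).
  rewrite /= => <-.
  set R1 := \sum_(r < V) _ in flat *.
  have : C * R1 <= gam * INR V / 2 * f n0.
    have -> : gam * INR V / 2 * f n0 = C * (gam / (2 * C) * INR V * f n0) by field; lra.
    by apply: Rmult_le_compat_l; lra.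
  have : gam * INR V * f n0 <= (\sum_(j < V) A j) * f n0 by apply: Rmult_le_compat_r; lra.
  have : gam * INR V / 2 * (gam / 4) <= gam * INR V / 2 * f n0.
    by apply: Rmult_le_compat_l; nra.
  lra.
apply: sumR_le => j jV _; rewrite /sh.
have -> : (j <= n0 + V.-1)%N by lia.
have -> : (n0 + V.-1 - j = n0 + (0 + V - j.+1))%N by lia.
set u := f (n0 + _)%N; have [? ?] := AC j.
have := Rle_abs (- (u - f n0)); rewrite Rabs_Ropp; have := Rabs_pos (u - f n0).
set r := Rabs _ => r0 ur.
have : 0 <= A j * (r - - (u - f n0)) by apply: Rmult_le_pos; lra.
have : 0 <= (C - A j) * r by apply: Rmult_le_pos; lra.
lra.
Qed.

(** The last prime range is placed so that it meets the flat stretch of [f_k] and all exponents add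
    up to the floor of [ln y]. [G] and [d] depend on [t] but not on [V], [x], [y], so one bound
    covers the whole interval that [Phi_small_primes] needs. *)
Lemma Phi_large_primes (g : nat -> R) (C gam : R) :
  multiplicative g -> (forall n, 0 <= g n) -> 0 < C -> 0 < gam ->
  (forall X j, psum g X j j.+1 <= C) ->
  (forall G : nat, exists V0 : nat, forall V i X : nat,
    (V0 <= V)%N -> (V <= i)%N -> (i + V <= G * V)%N -> exp (INR (i + V)) < INR X ->
    gam * INR V <= psum g X i (i + V)) ->
  forall t : nat, exists (G : nat) (d : R) (V0 : nat), [/\ (0 < G)%N, 0 < d &
    forall (V X : nat) (x y : R), (V0 <= V)%N -> 0 < x < INR X ->
      INR (G * V) <= ln x <= INR (G * V + G) -> x * exp (- INR (t * V)) <= y <= x ->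
      d * y / INR V <= Phi g X [pred p | ltR (exp (INR V)) (INR p)] y].
Proof.
move=> gM g0 C0 gam0 AC dens t.
have [Q HQ] := nat_above (4 * C / gam).
have [K HK] := nat_above (256 * INR Q * C ^ 2 / gam ^ 2).
have rQ : 0 < INR Q.
  by apply: Rle_lt_trans HQ; apply: Rle_mult_inv_pos => //; lra.
have rK : 0 < INR K.
  by apply: Rle_lt_trans HK; apply: Rle_mult_inv_pos; nra.
have K0 : (0 < K)%N by case: (K) rK => //=; lra.
(* [w] makes [W = w V] exceed the widening [K + K2 V] of the support, and [s0 V] bounds [offset].
   [G - t] leaves room, even below the least [y], for the offset, for [n0 < 2 W], and for a last
   range beyond [V + W + k V]. *)
have [K2 K2E] : {K2 | K2 = (K ^ 2)%N} by exists (K ^ 2)%N.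
have [w wE] : {w | w = (K2 + K + 2)%N} by exists (K2 + K + 2)%N.
have [s0 s0E] : {s0 | s0 = (1 + K2 * (1 + w + K2))%N} by exists (1 + K2 * (1 + w + K2))%N.
have [G GE] : {G | G = (t + s0 + 3 * w + K2 + 5)%N} by exists (t + s0 + 3 * w + K2 + 5)%N.
have [V1 HV1] := dens G.
have rG : 0 < INR G by apply: pos_INR_lt; lia.
(* [gam / G] equals [gam V / N]. The number [k] of steps varies with [V]; the cap at 1 makes
   [q ^ K2] a lower bound for every [k < K2]. *)
pose q := Rmin 1 (gam / INR G).
have gG : 0 < gam / INR G by apply: Rmult_lt_0_compat => //; apply: Rinv_0_lt_compat.
have q0 : 0 < q by apply: Rmin_pos; lra.
(* The factors come from the box, the [k] averaging steps, the flat convolution, two divisions by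
   [N = G V], and the rounding of exponents. *)
pose d := exp (- INR K) * q ^ K2 * (gam ^ 2 / 8) / INR G ^ 2 * exp (- INR (K2 + 3)).
exists G, d, (V1 + K2 + G + 5)%N; split; first by lia.
  have := pow_lt q K2 q0; have := exp_pos (- INR K); have := exp_pos (- INR (K2 + 3)).
  move=> ? ? ?; rewrite /d /Rdiv.
  by repeat (apply: Rmult_lt_0_compat || apply: Rinv_0_lt_compat || apply: pow_lt); lra.
move=> V X x y VV [x0 xX] [lx1 lx2] [y1 y2].
have V0 : (0 < V)%N by lia.
have rV := pos_INR_lt V V0.
pose W := (w * V)%N.
pose N := (G * V)%N.
have eN i : (i <= N)%N -> exp (INR i) < INR X.
  move=> /exp_INR_le iN; apply: Rle_lt_trans xX; apply: Rle_trans iN _.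
  rewrite -[X in _ <= X](exp_ln x) //.
  by case: lx1 => [lt|->]; [apply: Rlt_le; apply: exp_increasing|apply: Rle_refl].
have block i : (V <= i)%N -> (i + V <= N)%N ->
    gam * INR V <= \sum_(j < V) psum g X (i + j) (i + j).+1.
  move=> Vi iN; apply: Rle_trans (psum_buckets g X i V g0).
  by apply: HV1 => //; [lia|apply: eN].
have ACj i : 0 <= psum g X i i.+1 <= C by split; [apply: psum_ge0|apply: AC].
have wG m : (m <= w + K2)%N -> (V + m * V + V <= N)%N.
  move=> mw; have -> : (V + m * V + V = (m + 2) * V)%N by lia.
  by rewrite /N leq_mul2r; apply/orP; right; lia.
have KV : (K <= K * V)%N by rewrite leq_pmulr.
have wV : (w * V = K2 * V + K * V + 2 * V)%N by rewrite wE !mulnDl.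
pose f0 := start_density g X V W K.
pose a := step_density g X V W.
have [f0C f0S f0e f0M] := box_conv_props W K C (fun j => psum g X (V + j) (V + j).+1) K0
  (Rlt_le _ _ C0) (fun j => ACj (V + j)%N).
rewrite -/(start_density g X V W K) in f0C f0S f0e f0M.
have a_lo i : (i < K2)%N -> gam * INR V <= \sum_(j < V) a i j.
  move=> iK; apply: block; first by lia.
  by have := wG (w + i)%N; rewrite /W; lia.
have SKW : (W + K + K2 * V <= 2 * W)%N by rewrite /W wV; lia.
have VW : (V < W)%N by rewrite /W wV; lia.
have [k [n0 [kK fn0 flat]]] : exists k n0, let f := smoothed V a f0 k in
    [/\ (k < K2)%N, gam / 4 <= f n0 &
    \sum_(r < V) Rabs (f (n0 + r)%N - f n0) <= gam / (2 * C) * INR V * f n0].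
  rewrite K2E; apply: (smoothed_flat C gam Q K V W (W + K)) => //.
  - by rewrite V0.
  - by rewrite /W wV; lia.
  - by rewrite -K2E.
  - rewrite f0M; last by rewrite /W wV; lia.
    apply: sum_blocks_ge => m mw.
    have := block (V + m * V)%N; rewrite (eq_bigr (fun j => psum g X (V + (m * V + j)) (V + (m * V + j)).+1)).
      by apply; [lia|apply: wG; lia].
    by move=> j _; rewrite addnA.
  - by move=> i j; apply: ACj.
  - by rewrite -K2E.
set f := smoothed V a f0 k in fn0 flat.
have A0 i : (i < k)%N -> 0 < \sum_(j < V) a i j.
  by move=> ik; have := a_lo i (ltn_trans ik kK); nra.
(* Beyond [2 W] the sequence vanishes, whereas [f n0 >= gam / 4]. *)
have n0W : (n0 < 2 * W)%N.
  rewrite ltnNge; apply/negP => Wn0.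
  have [||||||_ fS _ _] := smoothed_props V (W + K + k * V) (W + K) C (C / INR K) a f0 k => //.
    by move=> i j; case: (ACj (V + W + i * V + j)%N).
  suff : f n0 = 0 by lra.
  by apply: fS; apply: leq_trans Wn0; apply: leq_trans SKW; rewrite leq_add2l leq_mul2r (ltnW kK) orbT.
have y0 : 0 < y by have := exp_pos (- INR (t * V)); nra.
have lny1 : ln x - INR (t * V) <= ln y.
  have -> : ln x - INR (t * V) = ln (x * exp (- INR (t * V))).
    by rewrite ln_mult ?ln_exp //; apply: exp_pos.
  by apply: ln_le_ln => //; apply: Rmult_lt_0_compat => //; apply: exp_pos.
have lny2 : ln y <= ln x by apply: ln_le_ln.
have tGV : (t * V <= G * V)%N by rewrite leq_mul2r; apply/orP; right; lia.
have lny0 : INR ((G - t) * V) <= ln y.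
  by rewrite mulnBl minus_INR; [lra|lia].
have [M [M1 M2]] := nat_floor (ln y) (Rle_trans _ _ _ (pos_INR _) lny0).
have Mlo : ((G - t) * V <= M)%N.
  rewrite -ltnS ltnNge; apply/negP => /leq_INR; lra.
have Mhi : (M <= G * V + G)%N.
  rewrite leqNgt; apply/negP => /leq_INR; rewrite S_INR; lra.
have := offset_bounds V w k; rewrite -/W; set s := offset V W k => /andP[slo shi].
have shi' : (s <= s0 * V)%N.
  apply: leq_trans shi _; rewrite leq_mul2r s0E leq_add2l leq_mul ?orbT //; lia.
have GtE : (G - t = s0 + 3 * w + K2 + 5)%N by lia.
rewrite GtE !mulnDl in Mlo.
have kV : (k * V <= K2 * V)%N by rewrite leq_mul2r (ltnW kK) orbT.
(* Start of the last range, solved from [s + b + (n0 + V - 1) + (k + 2) = M]. *)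
pose b := (M - (k + 1 + s + n0 + V))%N.
have bE : (b + (k + 1 + s + n0 + V) = M)%N by rewrite /b subnK //; lia.
have bhi : (V + W + k * V <= b)%N by rewrite /W in n0W *; lia.
(* [M] may exceed [G V] by [G]; this is absorbed by [s >= V >= G]. *)
have bN : (b + V <= N)%N by rewrite /N; lia.
have eM : exp (INR M) <= y.
  rewrite -[X in _ <= X](exp_ln y) //.
  by case: M1 => [lt|->]; [apply: Rlt_le; apply: exp_increasing|apply: Rle_refl].
have kN : (V + W + k * V <= N)%N by lia.
have chain := Phi_chain g X V W K N gam k gM g0 gam0 K0 V0 kN
  (fun i ik => a_lo i (ltn_trans ik kK)).
rewrite -/s -/f in chain.
set D := exp (- INR K) / INR N * _ in chain.
pose P' : nat_pred := [pred p | ltR (exp (INR V)) (INR p)].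
have step := Phi_step g X N V s k.+1 b [pred p | expitv V (V + W + k * V) p] P' D f
  gM g0 _ _ _ bN chain (n0 + V.-1).
have nE : (s + b + (n0 + V.-1) + k.+2 = M)%N by lia.
rewrite nE in step.
apply: Rle_trans (Phi_mono g X P' P' _ _ g0 _ eM) => //.
apply: Rle_trans (step _ _ _ _); first last.
- lra.
- move=> p pp /andP[/ltRP pl _]; rewrite inE; apply/ltRP; apply: Rle_lt_trans pl.
  by apply: exp_INR_le; lia.
- by move=> p; rewrite !inE => /andP[].
- by move=> p; rewrite inE => /andP[_ /leRP pu]; apply: Rle_trans pu _; apply: exp_INR_le.
have conv := flat_convolution_ge V n0 C gam (fun j => psum g X (b + j) (b + j).+1) f
  V0 gam0 C0 (fun j => ACj (b + j)%N) (block b _ bN) fn0 flat.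
have rN : INR N = INR G * INR V by rewrite /N mult_INR.
(* [ln y] is below [M + 1], and the [k + 2] units lost to buckets are at most [K2 + 2]. *)
have ey : y * exp (- INR (K2 + 3)) <= exp (INR (s + b + (n0 + V.-1))).
  rewrite -[X in X * _ <= _](exp_ln y) // -exp_plus.
  apply: Rlt_le; apply: exp_increasing.
  have : (M.+1 <= s + b + (n0 + V.-1) + (K2 + 3))%N by lia.
  by move=> /leq_INR; rewrite plus_INR; lra.
have qk : q ^ K2 <= (gam * INR V / INR N) ^ k.
  have -> : gam * INR V / INR N = gam / INR G by rewrite rN; field; lra.
  apply: (Rle_trans _ (q ^ k)).
    have -> : (K2 = k + (K2 - k))%N by lia.
    rewrite pow_add -[X in _ <= X]Rmult_1_r; apply: Rmult_le_compat_l; first by apply: pow_le; lra.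
    rewrite -(pow1 (K2 - k)); apply: pow_incr; split; [lra|exact: Rmin_l].
  by apply: pow_incr; split; [lra|exact: Rmin_r].
have eK := exp_pos (- INR K).
have qK := pow_lt q K2 q0.
have -> : d * y / INR V = (exp (- INR K) * q ^ K2 / INR N / INR N) *
    (y * exp (- INR (K2 + 3))) * (gam ^ 2 / 8 * INR V).
  by rewrite /d rN; field; lra.
have rN0 : 0 < INR N by rewrite rN; apply: Rmult_lt_0_compat.
have i0 : 0 < / INR N by apply: Rinv_0_lt_compat.
apply: Rmult_le_compat; last first.
- by apply: conv; lia.
- apply: Rmult_le_compat => //.
  + rewrite /Rdiv; repeat (apply: Rmult_le_pos); lra.
  + by apply: Rmult_le_pos; [lra|apply: Rlt_le; apply: exp_pos].
  + rewrite /D /Rdiv; apply: Rmult_le_compat_r; first lra.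
    have -> : exp (- INR K) * q ^ K2 * / INR N = exp (- INR K) * / INR N * q ^ K2 by ring.
    by apply: Rmult_le_compat_l => //; apply: Rmult_le_pos; lra.
- by apply: Rmult_le_pos; nra.
- apply: Rmult_le_pos; first by rewrite /Rdiv; repeat (apply: Rmult_le_pos); lra.
  by apply: Rmult_le_pos; [lra|apply: Rlt_le; apply: exp_pos].
Qed.

(** * Inserting the small primes *)

Lemma prodR_le_exp (n : nat) (P : pred nat) (u : nat -> R) :
  (forall i, (i < n)%N -> P i -> 0 <= u i) ->
  \big[Rmult/1]_(0 <= i < n | P i) (1 + u i) <= exp (\sum_(i < n | P i) u i).
Proof.
move=> u0; rewrite big_nat_cond [X in exp X]big_nat_cond.
apply: (proj2 (A := 0 <= _)); apply: (big_ind2 (fun x y => 0 <= x <= exp y)).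
- by rewrite exp_0; lra.
- move=> x1 x2 y1 y2 [? ?] [? ?]; rewrite exp_plus.
  by split; [exact: Rmult_le_pos|exact: Rmult_le_compat].
- move=> i /andP[/andP[_ iN] Pi].
  by have := u0 i iN Pi; have := exp_ineq1_le (u i); lra.
Qed.

Lemma prodR_ge1 (n : nat) (P : pred nat) (u : nat -> R) :
  (forall i, P i -> 0 <= u i) -> 1 <= \big[Rmult/1]_(0 <= i < n | P i) (1 + u i).
Proof.
move=> u0; apply: (big_ind (fun x => 1 <= x)) => [|x y x1 y1|i /u0]; [lra| |lra].
by rewrite -[X in X <= _]Rmult_1_r; apply: Rmult_le_compat; lra.
Qed.

Lemma prime_inv_le (p : nat) : prime p -> 0 < / INR p <= 1.
Proof.
move=> /prime_INR_ge2 p2; split; first by apply: Rinv_0_lt_compat; lra.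
by rewrite -Rinv_1; apply: Rinv_le_contravar; lra.
Qed.

Lemma sumR_recr (n : nat) (P : pred nat) (F : nat -> R) :
  \sum_(i < n.+1 | P i) F i = \sum_(i < n | P i) F i + (if P n then F n else 0).
Proof. by rewrite big_mkcond big_nat_recr //= -big_mkcond. Qed.

Lemma prodR_recr (n : nat) (P : pred nat) (F : nat -> R) :
  \big[Rmult/1]_(0 <= i < n.+1 | P i) F i =
  \big[Rmult/1]_(0 <= i < n | P i) F i * (if P n then F n else 1).
Proof. by rewrite big_mkcond big_nat_recr //= -big_mkcond. Qed.

(* The lower bound is affine in [ln y]; adding a prime [p] multiplies it by [1 + g p / p]
   at the price of lowering the bracket by [g p * ln p / (p * T)]. *)
Lemma Phi_small_primes (g : nat -> R) (X V : nat) (x d T : R) :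
  multiplicative g -> (forall n, 0 <= g n) -> 0 <= d -> 0 < T -> x < INR X ->
  exp (INR V) <= x ->
  (forall y, x * exp (- T) <= y <= x ->
     d * y <= Phi g X [pred p | ltR (exp (INR V)) (INR p)] y) ->
  forall z : nat, INR z <= exp (INR V) -> forall y, 0 < y <= x ->
    d * y * \big[Rmult/1]_(0 <= p < z.+1 | prime p) (1 + g p / INR p) *
      (1 - (ln x - ln y + \sum_(p < z.+1 | prime p) g p * ln (INR p) / INR p) / T)
    <= Phi g X [pred p | ltR (exp (INR V)) (INR p) || (p <= z)%N] y.
Proof.
move=> gM g0 d0 T0 xX eVx core; elim=> [|z IH] zV y [y0 yx].
  have sub : {subset [pred p | ltR (exp (INR V)) (INR p)] <=
                     [pred p | ltR (exp (INR V)) (INR p) || (p <= 0)%N]}.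
    by move=> p; rewrite !inE => ->.
  apply: Rle_trans (Phi_mono g X _ _ y y g0 sub (Rle_refl y)).
  have x0 : 0 < x by lra.
  rewrite big_mkcond big_nat1 sumR_0 /=; last by case.
  rewrite Rplus_0_r Rmult_1_r.
  have dy : 0 <= d * y by apply: Rmult_le_pos; lra.
  (* Below [x * exp (- T)] the bracket is at most 0, so nothing has to be known about [Phi]
     there. *)
  case: (Rle_dec (x * exp (- T)) y) => [hy|hy].
    apply: Rle_trans (core y (conj hy yx)).
    rewrite -[X in _ <= X]Rmult_1_r; apply: Rmult_le_compat_l => //.
    suff : 0 <= (ln x - ln y) / T by lra.
    by apply: Rle_mult_inv_pos => //; have := ln_le_ln y x y0 yx; lra.
  apply: (Rle_trans _ 0); last exact: Phi_ge0.
  suff : 1 <= (ln x - ln y) / T by nra.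
  apply: (Rmult_le_reg_r T) => //.
  have -> : (ln x - ln y) / T * T = ln x - ln y by field; lra.
  have : ln y <= ln (x * exp (- T)) by apply: ln_le_ln; lra.
  by rewrite ln_mult ?ln_exp //; [lra|apply: exp_pos].
have zV' : INR z <= exp (INR V) by rewrite S_INR in zV; lra.
have {}IH := IH zV'.
rewrite (prodR_recr z.+1) (sumR_recr z.+1).
set Pz := \big[Rmult/1]_(0 <= p < z.+1 | prime p) _ in IH *.
set Sz := \sum_(p < z.+1 | prime p) _ in IH *.
set P := [pred p : nat | ltR (exp (INR V)) (INR p) || (p <= z)%N] in IH.
set P' := [pred p : nat | ltR (exp (INR V)) (INR p) || (p <= z.+1)%N].
have sub : {subset P <= P'} by move=> p; rewrite !inE => /orP[->//|/leqW ->]; rewrite orbT.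
have Pz1 : 1 <= Pz.
  apply: prodR_ge1 => p /prime_INR_ge2 p2; apply: Rle_mult_inv_pos => //; lra.
case: ifP => pz; last first.
  by rewrite Rmult_1_r Rplus_0_r; apply: Rle_trans (IH y (conj y0 yx)) _; apply: Phi_mono => //; lra.
set p := z.+1 in zV pz P' sub *.
have p2 := prime_INR_ge2 p pz; have lp := prime_ln_ge0 p pz.
have pX : (p < X)%N by case: leqP => // /leq_INR; lra.
have X1 : (1 < X)%N by have := prime_gt1 pz; lia.
(* Only the powers [1] and [p] of the new prime are counted; this already gives the factor
   [1 + g p / p]. *)
pose Q q := (q == 1%N) || (q == p).
have QP q : Q q -> q = 1%N \/ [/\ prime q, q \notin P & q \in P'].
  case/orP=> /eqP ->; [by left|right; split=> //; last by rewrite inE leqnn orbT].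
  by rewrite inE /p ltnn orbF; apply/ltRP; rewrite -/p; lra.
apply: Rle_trans (Phi_split g X P P' Q y gM g0 _ QP sub); last lra.
have -> : \sum_(q < X | Q q) g q * Phi g X P (y / INR q) =
    Phi g X P y + g p * Phi g X P (y / INR p).
  transitivity (\sum_(q < X | q == 1%N) g q * Phi g X P (y / INR q) +
                \sum_(q < X | q == p) g q * Phi g X P (y / INR q)).
    rewrite big_mkcond [X in X + _]big_mkcond [X in _ + X]big_mkcond -sumRD.
    apply: sumR_eq => q _ _; rewrite /Q; case: (q =P 1%N) => [->|_] /=; last by ring.
    by have -> : (1%N == p) = false; [have := prime_gt1 pz; case: eqP => //; lia|ring].
  rewrite !big_nat1_eq X1 pX /= (proj1 gM) Rmult_1_l.
  by congr (Phi _ _ _ _ + _); field.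
have yp : 0 < y / INR p <= x.
  have [? ?] := prime_inv_le p pz; split; first by apply: Rmult_lt_0_compat.
  apply: Rle_trans yx; rewrite -[X in _ <= X]Rmult_1_r.
  by apply: Rmult_le_compat_l; lra.
have I1 := IH y (conj y0 yx); have I2 := IH (y / INR p) yp.
have lnyp : ln (y / INR p) = ln y - ln (INR p).
  have ip := prime_inv_le p pz.
  by rewrite /Rdiv ln_mult ?ln_Rinv //; lra.
rewrite lnyp in I2.
have gp := g0 p.
have I3 := Rmult_le_compat_l _ _ _ gp I2.
apply: Rle_trans (Rplus_le_compat _ _ _ _ I1 I3).
have -> : g p * (d * (y / INR p) * Pz * (1 - (ln x - (ln y - ln (INR p)) + Sz) / T)) =
   d * y * Pz * (g p / INR p * (1 - (ln x - ln y + Sz) / T) - g p / INR p * (ln (INR p) / T)).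
  by field; lra.
have -> : d * y * (Pz * (1 + g p / INR p)) *
    (1 - (ln x - ln y + (Sz + g p * ln (INR p) / INR p)) / T) =
   d * y * Pz * ((1 + g p / INR p) * (1 - (ln x - ln y + Sz) / T)
     - (1 + g p / INR p) * (g p / INR p) * (ln (INR p) / T)).
  by field; lra.
rewrite -Rmult_plus_distr_l; apply: Rmult_le_compat_l.
  by apply: Rmult_le_pos; [apply: Rmult_le_pos|]; lra.
have : 0 <= g p / INR p by apply: Rle_mult_inv_pos; lra.
have : 0 <= ln (INR p) / T by apply: Rle_mult_inv_pos.
set u := g p / INR p; set v := ln (INR p) / T => v0 u0.
(* The two brackets differ by exactly [u ^ 2 * v]. *)
have : 0 <= u * u * v by apply: Rmult_le_pos => //; apply: Rmult_le_pos.
by nra.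
Qed.

Lemma Phi_le_rsum (g : nat -> R) (X : nat) (P : nat_pred) (x : R) :
  (forall n, 0 <= g n) -> x < INR X -> Phi g X P x <= rsum_le x (fun _ => true) g.
Proof.
move=> g0 xX; rewrite (rsum_leE _ _ _ X) //; apply: sumR_subset => // n nX.
by move=> /andP[/andP[n0 _] nx]; rewrite nX n0 nx.
Qed.

Lemma psum_le_linear (g : nat -> R) (X i V : nat) (C : R) :
  (forall n, 0 <= g n) -> (forall j, psum g X j j.+1 <= C) ->
  psum g X i (i + V) <= C * INR V.
Proof.
move=> g0 AC; apply: Rle_trans (psum_buckets g X i V g0) _.
rewrite Rmult_comm -sumR_const; apply: sumR_le => j _ _; exact: AC.
Qed.

(** Primes above [Z] exceed [e^V], so [1 <= ln p / V], and the sum of [g p / p] over them is at most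
    [1 / V] times a [psum] of length [U]. *)
Lemma rprod_le (g : nat -> R) (X V U Z : nat) (x C : R) :
  (forall n, 0 <= g n) -> (forall j, psum g X j j.+1 <= C) -> (0 < V)%N ->
  x < INR X -> x <= exp (INR (V + U)) -> exp (INR V) < INR Z.+1 -> (Z < X)%N ->
  rprod_primes_le x (fun p => 1 + g p / INR p) <=
  \big[Rmult/1]_(0 <= p < Z.+1 | prime p) (1 + g p / INR p) * exp (C * INR U / INR V).
Proof.
move=> g0 AC V0 xX xU VZ ZX; have rV := pos_INR_lt V V0.
have u0 p : prime p -> 0 <= g p / INR p.
  by move=> /prime_INR_ge2 ?; apply: Rle_mult_inv_pos => //; lra.
rewrite (rprod_primes_leE _ _ X) // (bigID (fun p => (p <= Z)%N)) /=.
have mono (P1 P2 : pred nat) n : (forall p, P2 p -> prime p) -> (forall p, P1 p -> P2 p) ->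
    0 <= \big[Rmult/1]_(0 <= p < n | P1 p) (1 + g p / INR p) <=
    \big[Rmult/1]_(0 <= p < n | P2 p) (1 + g p / INR p).
  move=> P2p P12; rewrite big_mkcond [X in _ <= _ <= X]big_mkcond /=.
  apply: (big_ind2 (fun a b => 0 <= a <= b)) => [|a1 a2 b1 b2 [? ?] [? ?]|p _]; [lra| |].
    by split; [exact: Rmult_le_pos|exact: Rmult_le_compat].
  case: ifP => [/P12 H|_]; first by rewrite H; have := u0 p (P2p p H); lra.
  by case: ifP => [/P2p/u0|_]; lra.
apply: Rmult_le_compat.
- by case: (mono (fun p => [&& (0 < p)%N, prime p & leR (INR p) x] && (p <= Z)%N) prime X) => //
    p /andP[/and3P[]].
- by case: (mono (fun p => [&& (0 < p)%N, prime p & leR (INR p) x] && ~~ (p <= Z)%N) prime X) => //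
    p /andP[/and3P[]].
- rewrite (big_nat_widen 0 Z.+1 X) //.
  apply: (proj2 (mono _ _ _ _ _)) => [p /andP[]//|p].
  by move=> /andP[/and3P[_ -> _] pZ]; rewrite ltnS.
apply: Rle_trans (prodR_le_exp X _ _ _) _ => [p _ /andP[/and3P[_ pp _] _]|].
  exact: u0.
suff H : \sum_(p < X | [&& (0 < p)%N, prime p & leR (INR p) x] && ~~ (p <= Z)%N) g p / INR p
    <= C * INR U / INR V.
  by case: H => [H|->]; [apply: Rlt_le; apply: exp_increasing|apply: Rle_refl].
apply: (Rle_trans _ (psum g X V (V + U) / INR V)); last first.
  apply: Rmult_le_compat_r; first by apply: Rlt_le; apply: Rinv_0_lt_compat.
  exact: psum_le_linear.
rewrite /psum /Rdiv sumRMr.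
apply: (Rle_trans _ (\sum_(p < X | [&& (0 < p)%N, prime p & leR (INR p) x] && ~~ (p <= Z)%N)
    g p * ln (INR p) * / INR p * / INR V)).
  apply: sumR_le => p _ /andP[/and3P[_ pp _]]; rewrite -ltnNge => Zp.
  have [? _] := prime_inv_le p pp; have ? := g0 p.
  have Vp : INR V <= ln (INR p).
    rewrite -(ln_exp (INR V)); apply: ln_le_ln; first exact: exp_pos.
    by have := leq_INR _ _ Zp; lra.
  have -> : g p * ln (INR p) * / INR p * / INR V = (g p * / INR p) * (ln (INR p) / INR V).
    by field; have := prime_INR_ge2 p pp; lra.
  rewrite -[X in X <= _]Rmult_1_r; apply: Rmult_le_compat_l; first by apply: Rmult_le_pos; lra.
  apply: (Rmult_le_reg_r (INR V)) => //.
  by have -> : ln (INR p) / INR V * INR V = ln (INR p); [field; lra|lra].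
apply: sumR_subset => [p /andP[pp _]|p pX /andP[/and3P[_ pp /leRP px]]].
  apply: Rmult_le_pos; first exact: psum_term_ge0.
  by apply: Rlt_le; apply: Rinv_0_lt_compat.
rewrite -ltnNge pX pp /= => Zp; apply/andP; split; last by apply/leRP; lra.
by apply/ltRP; have := leq_INR _ _ Zp; lra.
Qed.

(** * Choice of constants, for bounded and for large [x] *)

Theorem theorem2 (g : nat -> R) (c : R)
  (g_mult : multiplicative g)
  (g_nonneg : forall n : nat, 0 <= g n)
  (g_bdd : exists B : R, forall p : nat, prime p -> g p <= B)
  (c_pos : 0 < c)
  (hyp : forall b : R, 0 < b < 1 ->
     (* liminf_{x -> oo} ((1-b) log x)^{-1} sum_{x^b < p <= x} g(p) log p / p >= c *)
     forall eps : R, 0 < eps -> exists X : R, forall x : R, X <= x ->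
       c - eps <=
         / ((1 - b) * ln x) *
           rsum_le x (fun p => prime p && Rlt_dec (Rpower x b) (INR p))
                     (fun p => g p * ln (INR p) / INR p)) :
  exists c0 : R, 0 < c0 /\
    forall x : R, 2 <= x ->
      rsum_le x (fun _ => true) g >=
        c0 * x / ln x * rprod_primes_le x (fun p => 1 + g p / INR p).
Proof.
have [B [B1 gB]] : exists B, 1 <= B /\ forall p, prime p -> g p <= B.
  case: g_bdd => B gB; exists (Rmax 1 B); split; first exact: Rmax_l.
  by move=> p /gB ?; apply: Rle_trans (Rmax_r 1 B).
pose C := B * (exp 1 * ln 16).
have ln2 : 0 < ln 2 by rewrite -ln_1; apply: ln_increasing; lra.
have C0 : 0 < C.
  have : 0 < ln 16 by rewrite -ln_1; apply: ln_increasing; lra.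
  by move=> ?; apply: Rmult_lt_0_compat; [lra|apply: Rmult_lt_0_compat => //; apply: exp_pos].
have AC X j : psum g X j j.+1 <= C by apply: psum_bucket_le => //; lra.
have gam0 : 0 < c / 3 by lra.
(* With [T = t V], the loss from inserting the primes up to [e^V] is at most [C V / T], hence below
   one half. *)
have [t Ht] := nat_above (2 * C).
have [G [d [V0 [G0 d0 core]]]] := Phi_large_primes g C (c / 3) g_mult g_nonneg C0 gam0 AC
  (density_lower g c g_nonneg c_pos hyp) t.
have rG := pos_INR_lt G G0.
pose x0 := exp (INR (G * V0.+2)).
have [X0 HX0] := nat_above x0.
(* For [2 <= x <= x0] the sum is at least [g 1 = 1], while [M0] bounds [x / ln x] times the product,
   which has fewer than [X0] prime factors [1 + g p / p <= exp B]. *)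
pose M0 := x0 / ln 2 * exp (INR X0 * B).
have M00 : 0 < M0.
  by rewrite /M0 /x0 /Rdiv; repeat (apply: Rmult_lt_0_compat || apply: Rinv_0_lt_compat || apply: exp_pos).
(* One half is the bracket left by the small primes; the exponential pays for the primes between
   [e^V] and [x]. *)
pose c1 := d / 2 * exp (- (2 * C * INR G)).
have c10 : 0 < c1 by apply: Rmult_lt_0_compat; [lra|apply: exp_pos].
have iM0 : 0 < / M0 by apply: Rinv_0_lt_compat.
exists (Rmin c1 (/ M0)); split; first exact: Rmin_pos.
move=> x x2; apply: Rle_ge.
have lnx : 0 < ln x by apply: Rlt_le_trans ln2 _; apply: ln_le_ln; lra.
have prod0 : 0 <= rprod_primes_le x (fun p => 1 + g p / INR p).
  have [X xX] := nat_above x; rewrite (rprod_primes_leE _ _ X) //.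
  apply: Rle_trans (prodR_ge1 _ _ _ _) => [|p /and3P[_ /prime_INR_ge2 ? _]]; first lra.
  by apply: Rle_mult_inv_pos => //; lra.
set PX := rprod_primes_le _ _ in prod0 *.
have weaken c' : Rmin c1 (/ M0) <= c' -> c' * x / ln x * PX <= rsum_le x (fun _ => true) g ->
    Rmin c1 (/ M0) * x / ln x * PX <= rsum_le x (fun _ => true) g.
  move=> cc; apply: Rle_trans; apply: Rmult_le_compat_r => //.
  apply: Rmult_le_compat_r; first by apply: Rlt_le; apply: Rinv_0_lt_compat.
  by apply: Rmult_le_compat_r; lra.
case: (Rle_dec x x0) => xx0.
  apply: (weaken (/ M0)); first exact: Rmin_r.
  have xX0 : x < INR X0 by lra.
  apply: (Rle_trans _ 1); last first.
    apply: Rle_trans (Phi_le_rsum g X0 pred0 x g_nonneg xX0).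
    by apply: Phi_ge1 => //; lra.
  have PX0 : PX <= exp (INR X0 * B).
    rewrite /PX (rprod_primes_leE _ _ X0) //.
    have u0 p : prime p -> 0 <= g p / INR p.
      by move=> /prime_INR_ge2 ?; apply: Rle_mult_inv_pos => //; lra.
    apply: Rle_trans (prodR_le_exp X0 _ _ _) _ => [p _ /and3P[_ pp _]|]; first exact: u0.
    suff : \sum_(p < X0 | [&& (0 < p)%N, prime p & leR (INR p) x]) g p / INR p <= INR X0 * B.
      by case=> [?|->]; [apply: Rlt_le; apply: exp_increasing|apply: Rle_refl].
    rewrite -sumR_const big_mkcond; apply: sumR_le => p _ _.
    case: ifP => [/and3P[_ pp _]|_]; last lra.
    have [? ?] := prime_inv_le p pp; have := gB p pp; have := g_nonneg p; rewrite /Rdiv; nra.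
  have -> : / M0 * x / ln x * PX = (x / ln x * PX) / M0 by field; lra.
  apply: (Rmult_le_reg_r M0) => //.
  have -> : x / ln x * PX / M0 * M0 = x / ln x * PX by field; lra.
  rewrite Rmult_1_l; apply: Rmult_le_compat => //.
    by apply: Rle_mult_inv_pos; lra.
  apply: Rmult_le_compat; [lra|by apply: Rlt_le; apply: Rinv_0_lt_compat|lra|].
  by apply: Rinv_le_contravar => //; apply: ln_le_ln; lra.
apply: (weaken c1); first exact: Rmin_l.
have lx0 : INR (G * V0.+2) < ln x.
  by rewrite -(ln_exp (INR (G * V0.+2))); apply: ln_increasing; [apply: exp_pos|rewrite -/x0; lra].
(* [V] is the floor of [ln x / G], so [G V <= ln x <= G V + G]; the size of [x0] then forces
   [V > V0]. *)
have [V [V1 V2]] := nat_floor (ln x / INR G) (Rle_mult_inv_pos _ _ (Rlt_le _ _ lnx) rG).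
have lxG : ln x = INR G * (ln x / INR G) by field; lra.
have GV1 : INR (G * V) <= ln x.
  by rewrite mult_INR lxG; apply: Rmult_le_compat_l; lra.
have GV2 : ln x <= INR (G * V + G).
  rewrite lxG plus_INR mult_INR; rewrite S_INR in V2.
  have := Rmult_le_compat_l (INR G) _ _ (Rlt_le _ _ rG) (Rlt_le _ _ V2); lra.
have VV : (V0 < V)%N.
  rewrite ltnNge; apply/negP => VV0.
  have : (G * V + G <= G * V0.+2)%N by rewrite -mulnSr leq_mul2l; lia.
  by move=> /leq_INR; lra.
have V00 : (0 < V)%N by lia.
have rV := pos_INR_lt V V00.
have VG : (V <= G * V)%N by rewrite leq_pmull.
have eVx : exp (INR V) <= x.
  rewrite -[X in _ <= X](exp_ln x); last lra.
  apply: Rle_trans (exp_INR_le _ _ VG) _.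
  by case: GV1 => [?|->]; [apply: Rlt_le; apply: exp_increasing|apply: Rle_refl].
have [X xX] := nat_above x.
pose T := INR (t * V).
have t0 : 0 < INR t by lra.
have T0 : 0 < T by rewrite /T mult_INR; apply: Rmult_lt_0_compat.
have [Z [Z1 Z2]] := nat_floor (exp (INR V)) (Rlt_le _ _ (exp_pos _)).
have ZX : (Z < X)%N by case: leqP => // /leq_INR; lra.
have large y : x * exp (- T) <= y <= x ->
    d / INR V * y <= Phi g X [pred p | ltR (exp (INR V)) (INR p)] y.
  move=> yx; have -> : d / INR V * y = d * y / INR V by rewrite /Rdiv; ring.
  by apply: (core V X x y) => //; [lia|lra].
have dV : 0 < d / INR V by apply: Rmult_lt_0_compat => //; apply: Rinv_0_lt_compat.
have xle : 0 < x <= x by lra.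
have small := Phi_small_primes g X V x (d / INR V) T g_mult g_nonneg (Rlt_le _ _ dV) T0 xX
  eVx large Z Z1 x xle.
apply: Rle_trans (Phi_le_rsum g X _ x g_nonneg xX).
apply: Rle_trans small.
set PZ := \big[Rmult/1]_(0 <= p < Z.+1 | prime p) _.
set SZ := \sum_(p < Z.+1 | prime p) _.
have SZle : SZ <= C * INR V.
  have := psum_le_linear g Z.+1 0 V C g_nonneg (AC Z.+1); apply: Rle_trans.
  apply: sumR_subset => [p /andP[pp _]|p pZ pp]; first exact: psum_term_ge0.
  rewrite pZ pp /expitv /= add0n; apply/andP; split.
    by apply/ltRP; rewrite exp_0; have := prime_INR_ge2 p pp; lra.
  by apply/leRP; have := leq_INR p Z pZ; lra.
have half : 1 / 2 <= 1 - (ln x - ln x + SZ) / T.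
  suff : SZ / T <= 1 / 2 by rewrite Rminus_diag Rplus_0_l; lra.
  apply: (Rmult_le_reg_r T) => //.
  have -> : SZ / T * T = SZ by field; lra.
  have : 0 <= (INR t - 2 * C) * INR V by apply: Rmult_le_pos; lra.
  by rewrite /T mult_INR; lra.
have PZ1 : 1 <= PZ.
  by apply: prodR_ge1 => p /prime_INR_ge2 ?; apply: Rle_mult_inv_pos => //; lra.
(* Here [U = G V + G] is at most [2 G V], whence the exponent [2 C G], independent of [x]. *)
have PXle : PX <= PZ * exp (2 * C * INR G).
  pose U := (G * V + G)%N.
  have xU : x <= exp (INR (V + U)).
    rewrite -[X in X <= _](exp_ln x); last lra.
    apply: (Rle_trans _ (exp (INR U))); last by apply: exp_INR_le; rewrite leq_addl.
    by case: GV2 => [?|->]; [apply: Rlt_le; apply: exp_increasing|apply: Rle_refl].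
  apply: Rle_trans (rprod_le g X V U Z x C g_nonneg (AC X) V00 xX xU Z2 ZX) _.
  apply: Rmult_le_compat_l; first by rewrite -/PZ; lra.
  suff : C * INR U / INR V <= 2 * C * INR G.
    by case=> [?|->]; [apply: Rlt_le; apply: exp_increasing|apply: Rle_refl].
  apply: (Rmult_le_reg_r (INR V)) => //.
  have -> : C * INR U / INR V * INR V = C * INR U by field; lra.
  have -> : 2 * C * INR G * INR V = C * (2 * (INR G * INR V)) by ring.
  apply: Rmult_le_compat_l; first lra.
  rewrite /U plus_INR mult_INR; have : 1 <= INR V by have := leq_INR _ _ V00.
  by nra.
have Vx : INR V <= ln x by apply: Rle_trans GV1; apply: leq_INR.
apply: (Rle_trans _ (d / INR V * x * PZ * (1 / 2))); last first.
  by apply: Rmult_le_compat_l => //; apply: Rmult_le_pos; [apply: Rmult_le_pos|]; lra.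
apply: (Rle_trans _ (c1 * x / ln x * (PZ * exp (2 * C * INR G)))).
  apply: Rmult_le_compat_l => //; apply: Rle_mult_inv_pos => //.
  by apply: Rmult_le_pos; lra.
have -> : c1 * x / ln x * (PZ * exp (2 * C * INR G)) = d * x * PZ * (1 / 2) * / ln x.
  have -> : exp (2 * C * INR G) = / exp (- (2 * C * INR G)) by rewrite exp_Ropp Rinv_inv.
  by rewrite /c1; have := exp_pos (- (2 * C * INR G)) => ?; field; lra.
have -> : d / INR V * x * PZ * (1 / 2) = d * x * PZ * (1 / 2) * / INR V by field; lra.
apply: Rmult_le_compat_l; first by repeat apply: Rmult_le_pos; lra.
exact: Rinv_le_contravar.
Qed.
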